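(* Let $a,b$ be relatively prime integers with $ab\neq 0$, and let $c_p,\widetilde c_p$ be the local Tamagawa numbers at a prime $p$ of $E_{C_5}(a,b)$ and $\widetilde E_{C_5}(a,b)$. The primes of bad reduction are exactly: the primes $p\mid ab$; the primes $p\geq 7$ dividing $a^2+11ab-b^2$; and $p=5$ when $5\mid a+18b$. Moreover: (i) if $n=v_p(ab)>0$ then $c_p=5n$ and $\widetilde c_p=n$; (ii) if $p\ge 7$ and $n=v_p(a^2+11ab-b^2)>0$: when $\left(\frac{-5(a^2+b^2)}{p}\right)=1$ we have $c_p=n$ and $\widetilde c_p=5n$; when $\left(\frac{-5(a^2+b^2)}{p}\right)=-1$ we have $c_p=\widetilde c_p=2$ if $n$ is even and $c_p=\widetilde c_p=1$ if $n$ is odd; (iii) if $v_5(a+18b)=1$ then $c_5=\widetilde c_5=1$, and if $v_5(a+18b)\ge 2$ then $c_5=\widetilde c_5=2$.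
   Context: For integers $a,b$, $E_{C_5}(a,b)$ is the curve $y^2+(a-b)xy-a^2by=x^3-abx^2$ over $\mathbb{Q}$ (with $(0,0)$ of order $5$), and $\widetilde E_{C_5}(a,b)$ is the curve $y^2+(a-b)xy-a^2by=x^3-abx^2+5ab(a^2-2ab-b^2)x+ab(a^4-15a^3b+5a^2b^2-10ab^3-b^4)$, a model of $E_{C_5}(a,b)/\langle(0,0)\rangle$. $\left(\frac{\cdot}{p}\right)$ is the Legendre symbol. The local Tamagawa number at $p$ of an elliptic curve $E/\mathbb{Q}$ is $c_p=[E(\mathbb{Q}_p):E_0(\mathbb{Q}_p)]$, computed with respect to a $p$-minimal model. *)

(* Defs.v *)
From HB Require Import structures.
From mathcomp Require Import all_boot all_order all_algebra.
Set Implicit Arguments. Unset Strict Implicit. Unset Printing Implicit Defensive.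
Import Order.TTheory GRing.Theory Num.Theory.
Local Open Scope ring_scope.

(* ---------- Weierstrass equations y^2+a1xy+a3y = x^3+a2x^2+a4x+a6 ---------- *)
Record wcoef (R : Type) := WC { wa1 : R; wa2 : R; wa3 : R; wa4 : R; wa6 : R }.

Definition wmap (R S : Type) (f : R -> S) (E : wcoef R) : wcoef S :=
  WC (f (wa1 E)) (f (wa2 E)) (f (wa3 E)) (f (wa4 E)) (f (wa6 E)).

Section Weierstrass.
Variable R : pzRingType.
Variable E : wcoef R.
Definition wb2 := wa1 E ^+ 2 + 4%:R * wa2 E.
Definition wb4 := 2%:R * wa4 E + wa1 E * wa3 E.
Definition wb6 := wa3 E ^+ 2 + 4%:R * wa6 E.
Definition wb8 := wa1 E ^+ 2 * wa6 E + 4%:R * wa2 E * wa6 E - wa1 E * wa3 E * wa4 E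
                  + wa2 E * wa3 E ^+ 2 - wa4 E ^+ 2.
Definition wdisc := - wb2 ^+ 2 * wb8 - 8%:R * wb4 ^+ 3 - 27%:R * wb6 ^+ 2
                    + 9%:R * wb2 * wb4 * wb6.
End Weierstrass.

Definition EC5 (a b : int) : wcoef int :=
  WC (a - b) (- (a * b)) (- (a ^+ 2 * b)) 0 0.
Definition EC5t (a b : int) : wcoef int :=
  WC (a - b) (- (a * b)) (- (a ^+ 2 * b))
     (5%:R * a * b * (a ^+ 2 - 2%:R * a * b - b ^+ 2))
     (a * b * (a ^+ 4 - 15%:R * a ^+ 3 * b + 5%:R * a ^+ 2 * b ^+ 2
               - 10%:R * a * b ^+ 3 - b ^+ 4)).

Section OverField.
Variable K : fieldType.

(* Standard change of variables x = u^2 x' + r, y = u^3 y' + s u^2 x' + t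
   (Silverman, Table 3.1). *)
Definition wchange (u r s t : K) (E : wcoef K) : wcoef K :=
  let: WC a1 a2 a3 a4 a6 := E in
  WC ((a1 + 2%:R * s) / u)
     ((a2 - s * a1 + 3%:R * r - s ^+ 2) / u ^+ 2)
     ((a3 + r * a1 + 2%:R * t) / u ^+ 3)
     ((a4 - s * a3 + 2%:R * r * a2 - (t + r * s) * a1 + 3%:R * r ^+ 2
        - 2%:R * s * t) / u ^+ 4)
     ((a6 + r * a4 + r ^+ 2 * a2 + r ^+ 3 - t * a3 - t ^+ 2 - r * t * a1)
        / u ^+ 6).

(* Points of E(K): None is the point at infinity O. *)
Definition wpoint := option (K * K)%type.

Definition on_curve (E : wcoef K) (P : wpoint) : bool :=
  match P with
  | None => true
  | Some (x, y) => y ^+ 2 + wa1 E * x * y + wa3 E * y ==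
                   x ^+ 3 + wa2 E * x ^+ 2 + wa4 E * x + wa6 E
  end.

Definition wneg (E : wcoef K) (P : wpoint) : wpoint :=
  match P with
  | None => None
  | Some (x, y) => Some (x, - y - wa1 E * x - wa3 E)
  end.

Definition wadd (E : wcoef K) (P Q : wpoint) : wpoint :=
  match P, Q with
  | None, _ => Q
  | _, None => P
  | Some (x1, y1), Some (x2, y2) =>
    if (x1 == x2) && (y1 + y2 + wa1 E * x2 + wa3 E == 0) then None
    else
      let l := if x1 == x2 then
                 (3%:R * x1 ^+ 2 + 2%:R * wa2 E * x1 + wa4 E - wa1 E * y1)
                   / (2%:R * y1 + wa1 E * x1 + wa3 E)
               else (y2 - y1) / (x2 - x1) in
      let nu := y1 - l * x1 in
      let x3 := l ^+ 2 + wa1 E * l - wa2 E - x1 - x2 in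
      Some (x3, - (l + wa1 E) * x3 - nu - wa3 E)
  end.

Variable v : K -> int.  (* valuation; its value at 0 is irrelevant *)

Definition vge (x : K) (m : int) : Prop := x = 0 \/ m <= v x.
Definition vunit (x : K) : Prop := x <> 0 /\ v x = 0.

(* (K, v) is (a copy of) the field Q_p of p-adic numbers: a field with a discrete
   valuation extending the p-adic valuation of Q, complete, with Q dense.
   These properties characterise Q_p up to valued-field isomorphism. *)
Definition is_Qp (p : nat) : Prop :=
  [/\ (forall n : nat, (0 < n)%N -> (n%:R : K) != 0),
      (forall x y : K, x != 0 -> y != 0 -> v (x * y) = v x + v y),
      (forall x y : K, x != 0 -> y != 0 -> x + y != 0 ->
                       Order.min (v x) (v y) <= v (x + y)),
      (forall n : nat, (0 < n)%N -> v (n%:R : K) = Posz (logn p n))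
    & ((forall s : nat -> K,
         (forall m : int, exists N : nat, forall i j : nat,
              (N <= i)%N -> (N <= j)%N -> vge (s i - s j) m) ->
         exists l : K, forall m : int, exists N : nat, forall i : nat,
              (N <= i)%N -> vge (s i - l) m)
    /\ (forall (x : K) (m : int), exists q : rat, vge (x - ratr q) m))].

Definition wintegral (E : wcoef K) : Prop :=
  [/\ vge (wa1 E) 0, vge (wa2 E) 0, vge (wa3 E) 0, vge (wa4 E) 0 & vge (wa6 E) 0].

Definition minimal_model (E E' : wcoef K) : Prop :=
  [/\ (exists u r s t : K, u != 0 /\ E' = wchange u r s t E),
      wintegral E' &
      (forall u r s t : K, u != 0 -> wintegral (wchange u r s t E) ->
        v (wdisc E') <= v (wdisc (wchange u r s t E)))].

(* E0(K): points of an integral model whose reduction is nonsingular.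
   A point with non-integral coordinates reduces to O (nonsingular);
   an integral point (x,y) reduces to a nonsingular point iff one of the
   partial derivatives of the Weierstrass equation is a unit at (x,y). *)
Definition in_E0 (E : wcoef K) (P : wpoint) : Prop :=
  match P with
  | None => True
  | Some (x, y) =>
      ~ (vge x 0 /\ vge y 0) \/
      (vge x 0 /\ vge y 0 /\
       (vunit (2%:R * y + wa1 E * x + wa3 E) \/
        vunit (3%:R * x ^+ 2 + 2%:R * wa2 E * x + wa4 E - wa1 E * y)))
  end.

Definition has_index (E : wcoef K) (c : nat) : Prop :=
  exists reps : 'I_c -> wpoint,
    [/\ forall i, on_curve E (reps i),
        forall i j, in_E0 E (wadd E (reps i) (wneg E (reps j))) -> i = j
      & forall P, on_curve E P ->
          exists i, in_E0 E (wadd E P (wneg E (reps i)))].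

Definition tamagawa (E : wcoef K) (c : nat) : Prop :=
  (exists E', minimal_model E E') /\
  (forall E', minimal_model E E' -> has_index E' c).

Definition bad_reduction (E : wcoef K) : Prop :=
  exists E', minimal_model E E' /\ 0 < v (wdisc E').

End OverField.

Definition intK (K : fieldType) (E : wcoef int) : wcoef K := wmap (fun z : int => z%:~R) E.

Definition legendre (x : int) (p : nat) : int :=
  if (p%:Z %| x)%Z then 0
  else if [exists y : 'I_p, (p%:Z %| (y%:Z) ^+ 2 - x)%Z] then 1 else -1.

Definition vpz (p : nat) (x : int) : nat := logn p `|x|%N.

(* Main.v *)
Require Import Defs.
From HB Require Import structures.
From mathcomp Require Import all_boot all_order all_algebra.
From mathcomp Require Import ring zify.
Import Order.TTheory GRing.Theory Num.Theory.
Local Open Scope ring_scope.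

Set Implicit Arguments.
Unset Strict Implicit.
Unset Printing Implicit Defensive.

(* Over Q_p, changes of variables between two minimal models are integral with unit scaling, hence
   they preserve the points of nonsingular reduction, and it suffices to treat one minimal model.
   Bad reduction is put in one of three normal forms with the singular point at the origin: at a
   split node, y^2 + a x y = x^3 + c with a a unit; at a nonsplit node, y^2 = x^3 + d x^2 + c with
   d not a square; at a cusp (only for p = 5), y^2 = x^3 + A x + B of type II, III or II*.
   A point lies outside E_0 iff p divides x. Whether P - Q lies in E_0 is therefore read off the
   valuation of x(P - Q), which is controlled by the numerators of x(P - Q) and x(P + Q) over
   (x1 - x2)^2 and by their product. For the split node the classes are indexed by the valuations of
   the two factors of y (y + a x) = x^3 + c, and there are v(c) of them.
   Modulo q = a^2 + 11 a b - b^2 the invariants c4 and c6 are constants times (ab)^2 and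
   (ab)^2 (a^2 + b^2), which decides splitness; for p = 5 one expands in powers of a + 18 b. *)

(** * Valuations *)

(** The index is given by representatives, so cosets have to be recognised from the coordinates of P
    - Q. The numerator over (x1 - x2)^2 gives no information when x1 and x2 are p-adically too
    close. The relation [x(P - Q) * sum_num = prod_num] then takes over, because [prod_num] has a
    dominant term independent of P and Q: [-a^2 c] at a split node, [-4 d c] at a nonsplit one,
    [A^2] for type III. The discriminants of the two curves are -(ab)^5 q and -ab q^5, which is the
    source of the exchange of n and 5n. The primes 2 and 3 never divide q, so they are bad only
    through ab; there the origin already reduces to the node and bringing the equation to normal
    form divides only by the unit a1 = a - b. Completing the square and the cube is reserved for p
    >= 5. *)

Definition veq (K : fieldType) (v : K -> int) (x : K) (m : int) : Prop :=
  x != 0 /\ v x = m.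

Section Valuation.
Variables (K : fieldType) (v : K -> int) (p : nat).
Hypothesis Qp : is_Qp v p.
Notation vge := (Defs.vge v).
Notation veq := (veq v).
Implicit Types (x y z : K) (m n : int).

Lemma natK_neq0 k : (0 < k)%N -> (k%:R : K) != 0.
Proof. by case: Qp => h _ _ _ _; apply: h. Qed.

Lemma val_mul x y : x != 0 -> y != 0 -> v (x * y) = v x + v y.
Proof. by case: Qp => _ h _ _ _; apply: h. Qed.

Lemma val_nat k : (0 < k)%N -> v (k%:R : K) = Posz (logn p k).
Proof. by case: Qp => _ _ _ h _; apply: h. Qed.

Lemma veq1 : veq 1 0.
Proof. by split; [rewrite oner_eq0 | rewrite (@val_nat 1) // logn1]. Qed.

Lemma veqM x y m n : veq x m -> veq y n -> veq (x * y) (m + n).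
Proof. by move=> [x0 <-] [y0 <-]; split; [rewrite mulf_neq0 | rewrite val_mul]. Qed.

Lemma veq_inj x m n : veq x m -> veq x n -> m = n.
Proof. by move=> [_ <-] [_ <-]. Qed.

Lemma veqN x m : veq x m -> veq (- x) m.
Proof.
move=> [x0 <-]; have n1 : (-1 : K) != 0 by rewrite oppr_eq0 oner_eq0.
split; first by rewrite oppr_eq0.
have := val_mul n1 n1; rewrite mulrNN mulr1 veq1.2 => h.
by rewrite -mulN1r val_mul //; lia.
Qed.

Lemma veqX x m k : veq x m -> veq (x ^+ k) (m * k%:Z).
Proof.
move=> hx; elim: k => [|k IH]; first by rewrite expr0 mulr0; apply: veq1.
by rewrite intS mulrDr mulr1 exprS; apply: veqM.
Qed.

Lemma veqV x m : veq x m -> veq x^-1 (- m).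
Proof.
move=> [x0 <-]; have x1 : x^-1 != 0 by rewrite invr_eq0.
split => //; have := val_mul x0 x1; rewrite divff // veq1.2; lia.
Qed.

Lemma veq_vge x m : veq x m -> vge x m.
Proof. by move=> [_ <-]; right. Qed.

Lemma vge0 m : vge 0 m.
Proof. by left. Qed.

Lemma vge_le m n x : vge x m -> n <= m -> vge x n.
Proof. by move=> [->|h] h'; [left | right; apply: le_trans h]. Qed.

Lemma vge_cases x m : vge x m -> veq x m \/ vge x (m + 1).
Proof.
move=> [->|h]; first by right; left.
have [x0|x0] := eqVneq x 0; first by right; left.
by have [e|ne] := eqVneq (v x) m; [left|right; right; lia].
Qed.

Lemma veq_vge_le x m n : veq x m -> vge x n -> n <= m.
Proof. by move=> [x0 <-] [e|//]; rewrite e eqxx in x0. Qed.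

Lemma veq_val x : x != 0 -> veq x (v x).
Proof. by []. Qed.

Lemma vgeD x y m : vge x m -> vge y m -> vge (x + y) m.
Proof.
have [->|x0] := eqVneq x 0; first by rewrite add0r.
have [->|y0] := eqVneq y 0; first by rewrite addr0.
have [->|s0] := eqVneq (x + y) 0; first by left.
move=> [/eqP|hx]; first by rewrite (negPf x0).
move=> [/eqP|hy]; first by rewrite (negPf y0).
right; case: Qp => _ _ h _ _; apply: le_trans (h _ _ x0 y0 s0).
by rewrite le_min hx.
Qed.

Lemma vgeN x m : vge x m -> vge (- x) m.
Proof.
have [->|x0] := eqVneq x 0; first by rewrite oppr0.
move=> [/eqP|hx]; first by rewrite (negPf x0).
by right; have [_ ->] := veqN (veq_val x0).
Qed.

Lemma vgeB x y m : vge x m -> vge y m -> vge (x - y) m.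
Proof. by move=> hx hy; apply: vgeD => //; apply: vgeN. Qed.

Lemma vgeM x y m n : vge x m -> vge y n -> vge (x * y) (m + n).
Proof.
have [->|x0] := eqVneq x 0; first by rewrite mul0r; left.
have [->|y0] := eqVneq y 0; first by rewrite mulr0; left.
move=> [/eqP|hx]; first by rewrite (negPf x0).
move=> [/eqP|hy]; first by rewrite (negPf y0).
by right; rewrite val_mul //; lia.
Qed.

Lemma vgeX x m k : vge x m -> vge (x ^+ k) (m * k%:Z).
Proof.
move=> hx; elim: k => [|k IH]; first by rewrite expr0 mulr0; apply/veq_vge/veq1.
by rewrite intS mulrDr mulr1 exprS; apply: vgeM.
Qed.

Lemma vge_nat k : vge k%:R 0.
Proof.
case: k => [|k]; first by left.
by right; rewrite val_nat.
Qed.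

Lemma vge_one : vge 1 0.
Proof. exact: (vge_nat 1). Qed.

Lemma vge_int (k : int) : vge k%:~R 0.
Proof. by case: k => k; [|apply: vgeN]; apply: vge_nat. Qed.

Lemma veqD x y m : veq x m -> vge y (m + 1) -> veq (x + y) m.
Proof.
move=> hx hy; have hxy : vge (x + y) m.
  by apply: vgeD; [apply: veq_vge | apply: vge_le hy _; lia].
have [//|h] := vge_cases hxy.
have : vge x (m + 1) by rewrite -(addrK y x); apply: vgeB.
move/(veq_vge_le hx); lia.
Qed.

Lemma vge_divr x y m n k : veq y n -> vge x m -> k <= m - n -> vge (x / y) k.
Proof. by move=> /veqV/veq_vge hy hx; apply: vge_le; apply: vgeM. Qed.

Lemma vge_mulr_cancel x y m n : veq y n -> vge (x * y) m -> vge x (m - n).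
Proof.
move=> hy hxy; rewrite -(mulfK hy.1 x).
exact: (vge_divr hy hxy).
Qed.

Lemma vge_all0 x : (forall m, vge x m) -> x = 0.
Proof.
move=> h; apply/eqP/negP => /negP x0.
have := veq_vge_le (veq_val x0) (h (v x + 1)); lia.
Qed.

Lemma vge_dec x m : vge x m \/ x != 0 /\ v x < m.
Proof.
have [x0|x0] := eqVneq x 0; first by left; left.
by have [h|h] := lerP m (v x); [left; right|right].
Qed.

(** Valuations are integers, so the bound [m - 1/2] on [v x] rounds up to [m]; cubes are treated
    alike. *)
Lemma vge_sqr x m : vge (x ^+ 2) (2 * m - 1) -> vge x m.
Proof.
case: (vge_dec x m) => // -[x0 h] hx.
have := veq_vge_le (veqX 2 (veq_val x0)) hx; lia.
Qed.

Lemma vge_cube x m : vge (x ^+ 3) (3 * m - 2) -> vge x m.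
Proof.
case: (vge_dec x m) => // -[x0 h] hx.
have := veq_vge_le (veqX 3 (veq_val x0)) hx; lia.
Qed.

Lemma veq_pi : prime p -> veq p%:R 1.
Proof.
move=> p_pr.
split; first by rewrite natK_neq0 // prime_gt0.
by rewrite val_nat ?prime_gt0 // -[X in logn _ X]expn1 pfactorK.
Qed.

End Valuation.

(* [vg v Q] proves goals [vge v e m]: sums are split, and each monomial is
   bounded by adding up the bounds found in the context for its factors. *)
Ltac vge_factor Q :=
  multimatch goal with
  | H : vge _ ?x _ |- vge _ ?x _ => exact H
  | H : veq _ ?x _ |- vge _ ?x _ => exact (veq_vge H)
  | |- _ =>
    first
    [ exact (vge_nat Q _) | exact (vge_one Q) | exact (vge_int Q _)
    | lazymatch goal with
      | |- vge _ (_ * _) _ => refine (vgeM Q _ _); [vge_factor Q | vge_factor Q]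
      | |- vge _ (_ ^+ _) _ => refine (vgeX Q _ _); vge_factor Q
      | |- vge _ (- _) _ => refine (vgeN Q _); vge_factor Q
      end ]
  end.
Ltac vg Q :=
  first
  [ solve [multimatch goal with
    | H : vge _ ?x _ |- vge _ ?x _ => refine (vge_le H _); lia
    | H : veq _ ?x _ |- vge _ ?x _ => refine (vge_le (veq_vge H) _); lia
    end]
  | lazymatch goal with
    | |- vge _ (_ + _) _ => apply: (vgeD Q); vg Q
    | |- vge _ (- _) _ => apply: (vgeN Q); vg Q
    | |- vge _ 0 _ => exact (vge0 _ _)
    | |- _ => solve [refine (vge_le _ _); [vge_factor Q | lia]]
    end ].

(** * Hensel's lemma and residues *)

Section Hensel.
Variables (K : fieldType) (v : K -> int) (p : nat).
Hypothesis Qp : is_Qp v p.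
Notation vge := (Defs.vge v).
Notation veq := (veq v).
Implicit Types x y z : K.

(** Iterating from 0, successive differences gain a power of p at each step, so completeness gives a
    limit. All the p-adic roots used later are fixed points of this kind. *)
Lemma contraction_fixpoint (g : K -> K) :
  (forall z, vge z 1 -> vge (g z) 1) ->
  (forall z w (m : int), vge z 1 -> vge w 1 -> vge (z - w) m -> vge (g z - g w) (m + 1)) ->
  exists2 z, vge z 1 & g z = z.
Proof.
move=> g1 gc; pose s n := iter n g 0.
have s1 n : vge (s n) 1 by elim: n => [|n IH]; [left | apply: g1].
have sd n : vge (s n.+1 - s n) n.+1%:Z.
  elim: n => [|n IH]; first by apply: (vgeB Qp); apply: s1.
  by have -> : n.+2%:Z = n.+1%:Z + 1 by [lia]; apply: (gc (s n.+1) (s n)).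
have sdd n k : vge (s (n + k)%N - s n) n.+1%:Z.
  elim: k => [|k IH]; first by rewrite addn0 subrr; left.
  have -> : s (n + k.+1)%N - s n = (s (n + k).+1 - s (n + k)%N) + (s (n + k)%N - s n).
    by rewrite addnS; ring.
  by apply: (vgeD Qp) => //; apply: vge_le (sd _) _; lia.
have sC (N i j : nat) : (N <= i)%N -> (N <= j)%N -> vge (s i - s j) N%:Z.
  move=> hi hj; have -> : s i - s j = (s (N + (i - N))%N - s N) - (s (N + (j - N))%N - s N).
    by rewrite !subnKC //; ring.
  by apply: (vgeB Qp); apply: vge_le (sdd _ _) _; lia.
have [l hl] : exists l, forall m : int, exists N : nat, forall i : nat, (N <= i)%N -> vge (s i - l) m.
  case: Qp => _ _ _ _ [h _]; apply: h => m; exists `|m|%N => i j hi hj.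
  by apply: vge_le (sC _ _ _ hi hj) _; lia.
have l1 : vge l 1.
  have [N /(_ N (leqnn _)) hN] := hl 1.
  by have -> : l = s N - (s N - l) by [ring]; apply: (vgeB Qp).
exists l => //; apply/eqP; rewrite -subr_eq0; apply/eqP.
apply: vge_all0 => m; have [N hN] := hl m.
have -> : g l - l = (s N.+1 - l) - (s N.+1 - g l) by ring.
apply: (vgeB Qp); first by apply: hN; lia.
by apply: (@vge_le _ _ (m + 1)); [apply: (gc (s N)) => //; apply: hN | lia].
Qed.

(** As [B] is a unit, the equation reads [z = g z] with [g z = - (C + A z^2 + D z^3) / B], and
    [g z - g w] is [z - w] times an element divisible by p. *)
Lemma cubic_hensel A B C D : vge A 0 -> veq B 0 -> vge C 1 -> vge D 0 ->
  exists2 z, vge z 1 & C + B * z + A * z ^+ 2 + D * z ^+ 3 = 0.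
Proof.
move=> hA hB hC hD.
pose g z := - (C + A * z ^+ 2 + D * z ^+ 3) / B.
have [z hz|z w m hz hw hzw|z hz gz] := @contraction_fixpoint g.
- by apply: (vge_divr Qp hB (m := 1)) => //; vg Qp.
- have -> : g z - g w = - (A * (z + w) + D * (z ^+ 2 + z * w + w ^+ 2)) * (z - w) / B.
    by rewrite /g; field; case: hB.
  apply: (vge_divr Qp hB (m := m + 1)); last by lia.
  have h : vge (A * (z + w) + D * (z ^+ 2 + z * w + w ^+ 2)) 1.
    have h1 : vge (z + w) 1 by vg Qp.
    have h2 : vge (z ^+ 2 + z * w + w ^+ 2) 1 by vg Qp.
    by vg Qp.
  by rewrite mulNr; apply: (vgeN Qp); apply: vge_le (vgeM Qp h hzw) _; lia.
exists z => //; have : g z * B = z * B by rewrite gz.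
by rewrite /g divfK ?hB.1 // => e; rewrite [B * z]mulrC -e; ring.
Qed.

Lemma quadratic_hensel A B C : vge A 0 -> veq B 0 -> vge C 1 ->
  exists2 z, vge z 1 & C + B * z + A * z ^+ 2 = 0.
Proof.
move=> hA hB hC; have [z z1 e] := cubic_hensel hA hB hC (vge0 v 0).
by exists z => //; rewrite -[RHS]e mul0r addr0.
Qed.

Hypothesis p_pr : prime p.

Lemma vge_intP (z : int) : reflect (vge z%:~R 1) (p%:Z %| z)%Z.
Proof.
apply: (iffP idP) => [/dvdzP[k ->]|].
  have hp := veq_pi Qp p_pr; rewrite intrM; vg Qp.
have aux (k : nat) : vge k%:R 1 -> (p %| k)%N.
  case: k => [|k] h; first by rewrite dvdn0.
  have hk : veq k.+1%:R (logn p k.+1) by split; [exact: (natK_neq0 Qp) | exact: (val_nat Qp)].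
  have := veq_vge_le hk h; rewrite lez_nat logn_gt0 mem_primes p_pr /=; lia.
rewrite /dvdz /=; case: z => k; first exact: aux.
by rewrite NegzE mulrNz => /(vgeN Qp); rewrite opprK; apply: aux.
Qed.

Lemma veq_int (z : int) : z != 0 -> veq z%:~R (logn p `|z|).
Proof.
have aux (k : nat) : (0 < k)%N -> veq k%:R (logn p k).
  by split; [exact: (natK_neq0 Qp) | exact: (val_nat Qp)].
case: z => k z0; first by apply: aux; lia.
by rewrite NegzE mulrNz; apply: (veqN Qp); apply: aux; lia.
Qed.

Lemma veq_int0 (z : int) : ~~ (p%:Z %| z)%Z -> veq z%:~R 0.
Proof.
move=> h; have z0 : z != 0 by apply: contraNneq h => ->; rewrite dvdz0.
have [//|h'] := vge_cases (vge_int Qp z).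
by case/negP: h; apply/vge_intP.
Qed.

Lemma veq_nat0 (k : nat) : ~~ (p %| k)%N -> veq k%:R 0.
Proof. by move=> h; apply: (veq_int0 (z := k%:Z)). Qed.

(** Density replaces [x] by a rational number. Being integral, it has denominator prime to p; its
    numerator times an inverse of the denominator mod p gives the residue. *)
Lemma residue x : vge x 0 -> exists2 k : nat, (k < p)%N & vge (x - k%:R) 1.
Proof.
move=> hx; have [q hq] : exists q : rat, vge (x - ratr q) 1.
  by case: Qp => _ _ _ _ [_ h]; apply: h.
have hr : vge (ratr q) 0.
  have -> : ratr q = x - (x - ratr q) by ring.
  by apply: (vgeB Qp) => //; apply: vge_le hq _.
have dn0 : ((denq q)%:~R : K) != 0 by have [] := veq_int (denq_neq0 q).
have hnd : ~~ (p%:Z %| denq q)%Z.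
  apply/negP => hd; have hd1 := elimT (vge_intP _) hd.
  have hn : vge (numq q)%:~R 1.
    have -> : (numq q)%:~R = ratr q * (denq q)%:~R :> K by rewrite /ratr divfK.
    by vg Qp.
  move/vge_intP: hn => hn.
  have := coprime_num_den q; rewrite /coprime => /eqP hg.
  have : (p %| gcdn `|numq q| `|denq q|)%N by rewrite dvdn_gcd; apply/andP.
  by rewrite hg dvdn1 => /eqP p1; move: (p_pr); rewrite p1.
have [u hu] : exists u : int, (p%:Z %| u * denq q - 1)%Z.
  have : coprimez p%:Z (denq q) by rewrite /coprimez /gcdz /= eqz_nat; rewrite -/(coprime _ _) prime_coprime.
  by case/coprimezP => -[a b] /= e; exists b; apply/dvdzP; exists (- a); rewrite -e; ring.
pose w := modz (numq q * u) p.
have p0 : p%:Z != 0 by have := prime_gt0 p_pr; lia.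
have w0 : 0 <= w by apply: modz_ge0.
have wp : w < p%:Z by rewrite /w; have := ltz_mod (numq q * u) p0; rewrite ger0_norm.
exists `|w|%N; first by lia.
have -> : (`|w|%N)%:R = w%:~R :> K by rewrite -[in RHS](gez0_abs w0).
have h1 : vge ((numq q * u - w)%:~R) 1.
  by apply/vge_intP; rewrite -eqz_mod_dvd /w modz_mod.
have h2 := elimT (vge_intP _) hu.
have hd := veq_int0 hnd.
have -> : x - w%:~R = (x - ratr q) + (numq q * u - w)%:~R
   - (numq q)%:~R * (u * denq q - 1)%:~R / (denq q)%:~R.
  by rewrite /ratr; field.
apply: (vgeB Qp); first by apply: (vgeD Qp).
by apply: (vge_divr Qp hd (m := 1)) => //; vg Qp.
Qed.

End Hensel.

(** * Changes of variables *)

Section ChangeOfVariables.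
Variable K : fieldType.
Implicit Types (E : wcoef K) (u r s t x y : K) (P Q : wpoint K).

Definition wc4 E := wb2 E ^+ 2 - 24%:R * wb4 E.
Definition wc6 E := - wb2 E ^+ 3 + 36%:R * wb2 E * wb4 E - 216%:R * wb6 E.

Definition wchange_pt u r s t P : wpoint K :=
  if P is Some (x, y) then
    Some ((x - r) / u ^+ 2, (y - s * (x - r) - t) / u ^+ 3)
  else None.

Lemma wdisc_change u r s t E : u != 0 ->
  wdisc (wchange u r s t E) = wdisc E / u ^+ 12.
Proof.
by case: E => *; rewrite /wdisc /wb2 /wb4 /wb6 /wb8 /=; field.
Qed.

Lemma wc4_change u r s t E : u != 0 -> wc4 (wchange u r s t E) = wc4 E / u ^+ 4.
Proof. by case: E => *; rewrite /wc4 /wb2 /wb4 /=; field. Qed.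

Lemma wchange_comp u1 r1 s1 t1 u2 r2 s2 t2 E : u1 != 0 -> u2 != 0 ->
  wchange u2 r2 s2 t2 (wchange u1 r1 s1 t1 E) =
  wchange (u1 * u2) (r1 + u1 ^+ 2 * r2) (s1 + u1 * s2)
          (t1 + u1 ^+ 3 * t2 + s1 * u1 ^+ 2 * r2) E.
Proof.
by case: E => a1 a2 a3 a4 a6 u10 u20 /=; congr WC; field; rewrite ?u10 ?u20.
Qed.

Lemma wchange_id E : wchange 1 0 0 0 E = E.
Proof. by case: E => a1 a2 a3 a4 a6 /=; rewrite !expr1n !divr1; congr WC; ring. Qed.

Lemma wchange_inv u r s t E : u != 0 ->
  wchange u^-1 (- r / u ^+ 2) (- s / u) ((r * s - t) / u ^+ 3) (wchange u r s t E) = E.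
Proof.
move=> u0; rewrite wchange_comp ?invr_eq0 // -[RHS]wchange_id.
by congr wchange; field.
Qed.

Lemma on_curve_change u r s t E P : u != 0 ->
  on_curve (wchange u r s t E) (wchange_pt u r s t P) = on_curve E P.
Proof.
move=> u0; case: P => [[x y]|//]; case: E => a1 a2 a3 a4 a6 /=.
rewrite -[LHS]subr_eq0 -[RHS]subr_eq0; set F := (X in _ = (X == 0)).
rewrite [X in (X == 0) = _](_ : _ = F / u ^+ 6); last by rewrite /F; field.
by rewrite mulf_eq0 invr_eq0 expf_eq0 (negPf u0) andbF orbF.
Qed.

Lemma wneg_change u r s t E P : u != 0 ->
  wneg (wchange u r s t E) (wchange_pt u r s t P) = wchange_pt u r s t (wneg E P).
Proof.
move=> u0; case: P => [[x y]|//]; case: E => a1 a2 a3 a4 a6 /=.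
by congr Some; congr pair; field.
Qed.

Lemma on_curve_neg E P : on_curve E (wneg E P) = on_curve E P.
Proof.
case: P => [[x y]|//]; case: E => a1 a2 a3 a4 a6 /=.
by congr (_ == _); ring.
Qed.

(** Subtracting the two equations leaves [(y1 - y2) * (y1 + y2 + a1 x + a3) = 0]. *)
Lemma on_curve_same_x E x y1 y2 : on_curve E (Some (x, y1)) -> on_curve E (Some (x, y2)) ->
  y1 + y2 + wa1 E * x + wa3 E != 0 -> y1 = y2.
Proof.
move=> /= /eqP h1 /eqP h2 n0; apply/eqP; rewrite -subr_eq0.
have : (y1 - y2) * (y1 + y2 + wa1 E * x + wa3 E) = 0.
  have -> : (y1 - y2) * (y1 + y2 + wa1 E * x + wa3 E) =
    (y1 ^+ 2 + wa1 E * x * y1 + wa3 E * y1) - (y2 ^+ 2 + wa1 E * x * y2 + wa3 E * y2) by ring.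
  by rewrite h1 h2 subrr.
by move/eqP; rewrite mulf_eq0 (negPf n0) orbF.
Qed.

(** The curve equations serve when the abscissas agree: [wadd] tests [y1 + y2 + a1 x2 + a3], but the
    tangent slope is divided by [2 y1 + a1 x1 + a3], and the two coincide once [y1 = y2] is
    known. *)
Lemma wadd_change u r s t E P Q : u != 0 -> on_curve E P -> on_curve E Q ->
  wadd (wchange u r s t E) (wchange_pt u r s t P) (wchange_pt u r s t Q) =
  wchange_pt u r s t (wadd E P Q).
Proof.
move=> u0; case: P => [[x1 y1]|//]; case: Q => [[x2 y2]|//] hP hQ.
rewrite /wadd /=.
have -> : ((x1 - r) / u ^+ 2 == (x2 - r) / u ^+ 2) = (x1 == x2).
  by rewrite (inj_eq (mulIf _)) ?invr_eq0 ?expf_neq0 // (inj_eq (addIr _)).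
have -> : ((y1 - s * (x1 - r) - t) / u ^+ 3 + (y2 - s * (x2 - r) - t) / u ^+ 3
     + wa1 (wchange u r s t E) * ((x2 - r) / u ^+ 2) + wa3 (wchange u r s t E) =
     (y1 + y2 + wa1 E * x2 + wa3 E - s * (x1 - x2)) / u ^+ 3).
  by case: E {hP hQ} => a1 a2 a3 a4 a6 /=; field.
have [e|n12] := eqVneq x1 x2; last first.
  rewrite /=; congr Some.
  by case: E {hP hQ} => a1 a2 a3 a4 a6 /=; congr pair; field; rewrite ?u0 /=;
     rewrite subr_eq0 ?(inj_eq (addIr _)) ?u0 //= eq_sym.
rewrite e subrr mulr0 subr0 mulf_eq0 invr_eq0 expf_eq0 (negPf u0) /= orbF.
case: eqP => // /eqP n0 /=; congr Some.
rewrite e in hP; have e12 := on_curve_same_x hP hQ n0.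
have {}n0 : 2%:R * y1 + wa1 E * x2 + wa3 E != 0 by move: n0; rewrite -e12 mulr_natl mulr2n.
have n1 : 2%:R * ((y1 - s * (x2 - r) - t) / u ^+ 3) + wa1 (wchange u r s t E) * ((x2 - r) / u ^+ 2)
   + wa3 (wchange u r s t E) = (2%:R * y1 + wa1 E * x2 + wa3 E) / u ^+ 3.
  by case: E {hP hQ n0} => a1 a2 a3 a4 a6 /=; field.
rewrite n1.
by case: E n0 {n1 hP hQ} => a1 a2 a3 a4 a6 /= n0; congr pair; field; rewrite u0 n0.
Qed.

Lemma wchange_pt_surj u r s t P : u != 0 -> exists Q, P = wchange_pt u r s t Q.
Proof.
move=> u0; case: P => [[x y]|]; last by exists None.
exists (Some (u ^+ 2 * x + r, u ^+ 3 * y + s * u ^+ 2 * x + t)) => /=.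
by congr Some; congr pair; field.
Qed.

End ChangeOfVariables.

(** * Minimal models *)

Section MinimalModels.
Variables (K : fieldType) (v : K -> int) (p : nat).
Hypothesis Qp : is_Qp v p.
Notation vge := (Defs.vge v).
Notation veq := (veq v).
Implicit Types (x y z r s t u : K) (E : wcoef K) (P : wpoint K).

Lemma vunitP z : vge z 0 -> vunit v z <-> ~ vge z 1.
Proof.
move=> hz; split=> [[/eqP z0 e] h|h]; first by have := veq_vge_le (conj z0 e) h.
by have [[z0 e]|//] := vge_cases hz; split=> //; apply/eqP.
Qed.

Lemma vgeVu u x m : veq u 0 -> vge x m -> vge (x / u) m.
Proof. by move=> hu hx; apply: (vge_divr Qp hu hx); rewrite subr0. Qed.

Lemma vge_divu u x m : veq u 0 -> vge (x / u) m <-> vge x m.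
Proof.
move=> hu; split; last exact: vgeVu.
by move=> h; rewrite -(divfK hu.1 x) -[m]addr0; apply: (vgeM Qp h (veq_vge hu)).
Qed.

Lemma veq0X u k : veq u 0 -> veq (u ^+ k) 0.
Proof. by move/(veqX Qp k); rewrite mul0r. Qed.

(** If [v y < 0], the equation bounds [v (y^2)] below by [v y], which exceeds [2 v y]. *)
Lemma wintegral_on_curve_y E x y : wintegral v E -> on_curve E (Some (x, y)) ->
  vge x 0 -> vge y 0.
Proof.
move=> [i1 i2 i3 i4 i6] /= /eqP e hx; case: (vge_dec v y 0) => // -[y0 yn].
have hy := veq_val v y0.
have : vge (y ^+ 2) (v y).
  have -> : y ^+ 2 = x ^+ 3 + wa2 E * x ^+ 2 + wa4 E * x + wa6 E
     - (wa1 E * x * y + wa3 E * y) by rewrite -e; ring.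
  vg Qp.
move/(veq_vge_le (veqX Qp 2 hy)); lia.
Qed.

Lemma in_E0P E x y : wintegral v E ->
  in_E0 v E (Some (x, y)) <->
  ~ (vge x 0 /\ vge y 0 /\ vge (2%:R * y + wa1 E * x + wa3 E) 1 /\
     vge (3%:R * x ^+ 2 + 2%:R * wa2 E * x + wa4 E - wa1 E * y) 1).
Proof.
move=> [i1 i2 i3 i4 i6]; rewrite /in_E0.
have hf : vge x 0 -> vge y 0 -> vge (2%:R * y + wa1 E * x + wa3 E) 0 by move=> *; vg Qp.
have hg : vge x 0 -> vge y 0 ->
  vge (3%:R * x ^+ 2 + 2%:R * wa2 E * x + wa4 E - wa1 E * y) 0 by move=> *; vg Qp.
split.
  case=> [h [? [? _]]|[hx [hy h]] [_ [_ [h1 h2]]]]; first by apply: h.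
  by case: h => /vunitP; [move/(_ (hf hx hy)) | move/(_ (hg hx hy))].
move=> h; have [hx|[x0 xn]] := vge_dec v x 0; last first.
  by left=> -[[e|hx] _]; [rewrite e eqxx in x0 | lia].
have [hy|[y0 yn]] := vge_dec v y 0; last first.
  by left=> -[_ [e|hy]]; [rewrite e eqxx in y0 | lia].
right; split=> //; split=> //.
have [[f0 /eqP fn]|hf1] := vge_cases (hf hx hy).
  by left; split; apply/eqP.
have [[g0 /eqP gn]|hg1] := vge_cases (hg hx hy); last by case: h.
by right; split; apply/eqP.
Qed.

(** The partial derivatives [f], [g] become [f / u^3] and [(g - s f) / u^4]: a triangular
    substitution with unit diagonal, which preserves their simultaneous vanishing mod p. *)
Lemma in_E0_change u r s t E P :
  wintegral v E -> wintegral v (wchange u r s t E) ->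
  veq u 0 -> vge r 0 -> vge s 0 -> vge t 0 ->
  in_E0 v (wchange u r s t E) (wchange_pt u r s t P) <-> in_E0 v E P.
Proof.
move=> iE iE' hu hr hs ht; case: P => [[x y]|] //.
rewrite [wchange_pt _ _ _ _ _]/=.
apply: (iff_trans (in_E0P _ _ iE')); apply: (iff_trans _ (iff_sym (in_E0P _ _ iE))).
have u0 := hu.1; have [i1 i2 i3 i4 i6] := iE.
set f := 2%:R * y + wa1 E * x + wa3 E.
set g := 3%:R * x ^+ 2 + 2%:R * wa2 E * x + wa4 E - wa1 E * y.
set x' := _ / u ^+ 2; set y' := _ / u ^+ 3.
have ef : 2%:R * y' + wa1 (wchange u r s t E) * x' + wa3 (wchange u r s t E) = f / u ^+ 3.
  by rewrite /x' /y' /f; case: E {iE iE' i1 i2 i3 i4 i6 f g} => *; rewrite /=; field.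
have eg : 3%:R * x' ^+ 2 + 2%:R * wa2 (wchange u r s t E) * x' + wa4 (wchange u r s t E)
    - wa1 (wchange u r s t E) * y' = (g - s * f) / u ^+ 4.
  by rewrite /x' /y' /f /g; case: E {iE iE' i1 i2 i3 i4 i6 f g ef} => *; rewrite /=; field.
rewrite ef eg /x' /y' {ef eg x' y'}.
rewrite !(vge_divu _ _ (veq0X _ hu)).
suff h : (vge (x - r) 0 /\ vge (y - s * (x - r) - t) 0 /\ vge f 1 /\ vge (g - s * f) 1) <->
   (vge x 0 /\ vge y 0 /\ vge f 1 /\ vge g 1) by split=> n /h.
split=> -[hx [hy [hf hg]]].
  have h1 : vge x 0 by rewrite -(subrK r x); apply: (vgeD Qp).
  split=> //; split; last first.
    by split=> //; rewrite -(subrK (s * f) g); apply: (vgeD Qp) => //; vg Qp.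
  have -> : y = (y - s * (x - r) - t) + (s * (x - r) + t) by ring.
  by apply: (vgeD Qp) => //; vg Qp.
have h1 : vge (x - r) 0 by vg Qp.
by split=> //; split; [vg Qp | split=> //; vg Qp].
Qed.

Lemma quartic_integral x A B C : vge A 0 -> vge B 0 -> vge C 0 ->
  x ^+ 4 = A * x ^+ 2 + B * x + C -> vge x 0.
Proof.
move=> hA hB hC e; case: (vge_dec v x 0) => // -[x0 xn].
have hx := veq_val v x0.
have : vge (x ^+ 4) (v x * 2) by rewrite e; vg Qp.
move/(veq_vge_le (veqX Qp 4 hx)); lia.
Qed.

Lemma quadratic_integral x B C : vge B 0 -> vge C 0 -> x ^+ 2 = B * x + C -> vge x 0.
Proof.
move=> hB hC e; case: (vge_dec v x 0) => // -[x0 xn].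
have hx := veq_val v x0.
have : vge (x ^+ 2) (v x) by rewrite e; vg Qp.
move/(veq_vge_le (veqX Qp 2 hx)); lia.
Qed.

(* The monic equation for [r] comes from eliminating [r ^+ 3] between the transformation
   rules of [b6] and [b8]; those of [a2] and [a6] are then monic quadratics in [s] and [t]. *)
Lemma wchange_integral u r s t E : veq u 0 ->
  wintegral v E -> wintegral v (wchange u r s t E) -> [/\ vge r 0, vge s 0 & vge t 0].
Proof.
move=> hu; have u0 := hu.1; case: E => a1 a2 a3 a4 a6.
set E' := wchange _ _ _ _ _; move=> [/= i1 i2 i3 i4 i6] iE'.
have [j1 j2 j3 j4 j6] := iE'.
have hr : vge r 0.
  have h6 : vge (wb6 E') 0 by rewrite /wb6; vg Qp.
  have h8 : vge (wb8 E') 0 by rewrite /wb8; vg Qp.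
  pose b4 := 2%:R * a4 + a1 * a3; pose b6 := a3 ^+ 2 + 4%:R * a6.
  pose b8 := a1 ^+ 2 * a6 + 4%:R * a2 * a6 - a1 * a3 * a4 + a2 * a3 ^+ 2 - a4 ^+ 2.
  have k4 : vge b4 0 by rewrite /b4; vg Qp.
  have k6 : vge b6 0 by rewrite /b6; vg Qp.
  have k8 : vge b8 0 by rewrite /b8; vg Qp.
  apply: (@quartic_integral r b4 (2%:R * b6 + u ^+ 6 * wb6 E') (b8 - u ^+ 8 * wb8 E')).
  - by [].
  - by vg Qp.
  - by vg Qp.
  - by rewrite /b4 /b6 /b8 /wb6 /wb8 /E' /=; field.
have hs : vge s 0.
  apply: (@quadratic_integral s (- a1) (a2 + 3%:R * r - u ^+ 2 * wa2 E')).
  - by vg Qp.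
  - by vg Qp.
  - by rewrite /E' /=; field.
split=> //; apply: (@quadratic_integral t (- (a3 + r * a1))
    (a6 + r * a4 + r ^+ 2 * a2 + r ^+ 3 - u ^+ 6 * wa6 E')).
- by vg Qp.
- by vg Qp.
- by rewrite /E' /=; field.
Qed.

Lemma vge_disc E : wintegral v E -> vge (wdisc E) 0.
Proof.
case: E => a1 a2 a3 a4 a6 [/= i1 i2 i3 i4 i6].
have h2 : vge (wb2 (WC a1 a2 a3 a4 a6)) 0 by rewrite /wb2 /=; vg Qp.
have h4 : vge (wb4 (WC a1 a2 a3 a4 a6)) 0 by rewrite /wb4 /=; vg Qp.
have h6 : vge (wb6 (WC a1 a2 a3 a4 a6)) 0 by rewrite /wb6 /=; vg Qp.
have h8 : vge (wb8 (WC a1 a2 a3 a4 a6)) 0 by rewrite /wb8 /=; vg Qp.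
by rewrite /wdisc; vg Qp.
Qed.

Lemma vge_c4 E : wintegral v E -> vge (wc4 E) 0.
Proof.
case: E => a1 a2 a3 a4 a6 [/= i1 i2 i3 i4 i6].
have h2 : vge (wb2 (WC a1 a2 a3 a4 a6)) 0 by rewrite /wb2 /=; vg Qp.
have h4 : vge (wb4 (WC a1 a2 a3 a4 a6)) 0 by rewrite /wb4 /=; vg Qp.
by rewrite /wc4; vg Qp.
Qed.

Lemma vge_c6 E : wintegral v E -> vge (wc6 E) 0.
Proof.
case: E => a1 a2 a3 a4 a6 [/= i1 i2 i3 i4 i6].
have h2 : vge (wb2 (WC a1 a2 a3 a4 a6)) 0 by rewrite /wb2 /=; vg Qp.
have h4 : vge (wb4 (WC a1 a2 a3 a4 a6)) 0 by rewrite /wb4 /=; vg Qp.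
have h6 : vge (wb6 (WC a1 a2 a3 a4 a6)) 0 by rewrite /wb6 /=; vg Qp.
by rewrite /wc6; vg Qp.
Qed.

(** Scaling [W] by [u] lowers the valuation of the discriminant by [12 v(u)] and that of [c4] by
    [4 v(u)]. Both must stay nonnegative for an integral competitor, so either criterion forces
    [v(u) <= 0]. *)
Lemma minimalI E W d : (exists u r s t, u != 0 /\ W = wchange u r s t E) ->
  wintegral v W -> veq (wdisc W) d -> d < 12 \/ veq (wc4 W) 0 -> minimal_model v E W.
Proof.
move=> hW iW hd crit; split=> // u' r' s' t' u'0.
have [u [r [s [t [u0 eW]]]]] := hW.
have -> : E = wchange u^-1 (- r / u ^+ 2) (- s / u) ((r * s - t) / u ^+ 3) W.
  by rewrite eW wchange_inv.
rewrite wchange_comp ?invr_eq0 //; set u2 := u^-1 * u'.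
have u20 : u2 != 0 by rewrite mulf_neq0 // invr_eq0.
move: (r in wchange _ r) (s in wchange _ _ s) (t in wchange _ _ _ t) => r2 s2 t2 i2.
have hu := veq_val v u20; have hu12 := veqV Qp (veqX Qp 12 hu); have hu4 := veqV Qp (veqX Qp 4 hu).
have hd2 := veqM Qp hd hu12; rewrite wdisc_change // hd.2 hd2.2.
suff : v u2 <= 0 by lia.
case: crit => [d12|h4].
  have := vge_disc i2; rewrite wdisc_change // => /(veq_vge_le hd2); lia.
have := vge_c4 i2; rewrite wc4_change // => /(veq_vge_le (veqM Qp h4 hu4)); lia.
Qed.

Lemma has_index_change u r s t E c : veq u 0 ->
  wintegral v E -> wintegral v (wchange u r s t E) ->
  has_index v E c -> has_index v (wchange u r s t E) c.
Proof.
move=> hu iE iE' [reps [h1 h2 h3]]; have u0 := hu.1.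
have [hr hs ht] := wchange_integral hu iE iE'.
exists (fun i => wchange_pt u r s t (reps i)); split=> [i|i j|P'].
- by rewrite on_curve_change.
- rewrite wneg_change // wadd_change // ?on_curve_neg //.
  by rewrite in_E0_change //; apply: h2.
have [P ->] := wchange_pt_surj r s t P' u0.
rewrite on_curve_change // => hP; have [i hi] := h3 P hP; exists i.
by rewrite wneg_change // wadd_change // ?on_curve_neg // in_E0_change.
Qed.

Lemma tamagawaI E W c : minimal_model v E W -> wdisc W != 0 -> has_index v W c ->
  tamagawa v E c.
Proof.
move=> mW dW hW; split; first by exists W.
move=> E' mE'; have [[u [r [s [t [u0 eW]]]]] iW minW] := mW.
have [[u' [r' [s' [t' [u'0 eE']]]]] iE' minE'] := mE'.
have eE : E = wchange u^-1 (- r / u ^+ 2) (- s / u) ((r * s - t) / u ^+ 3) W.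
  by rewrite eW wchange_inv.
(* Each of the two models bounds the discriminant of the other, so [12 v(u2) = 0] and the scaling
   [u2] between them is a unit. *)
have le1 : v (wdisc W) <= v (wdisc E') by rewrite eE'; apply: minW; rewrite -?eE'.
have le2 : v (wdisc E') <= v (wdisc W) by rewrite eW; apply: minE'; rewrite -?eW.
move: iE' le1 le2; rewrite {}eE' {}eE wchange_comp ?invr_eq0 //; set u2 := u^-1 * u'.
have u20 : u2 != 0 by rewrite mulf_neq0 // invr_eq0.
move: (r in wchange _ r) (s in wchange _ _ s) (t in wchange _ _ _ t) => r2 s2 t2 i2.
have hu := veq_val v u20; have hd := veqM Qp (veq_val v dW) (veqV Qp (veqX Qp 12 hu)).
rewrite wdisc_change // hd.2 => le1 le2.
by apply: has_index_change => //; split=> //; lia.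
Qed.

End MinimalModels.

(** * Differences of points near the singular point *)

Section Difference.
Variable K : fieldType.
Implicit Types (E : wcoef K) (x y : K) (P Q : wpoint K).

Lemma on_curve_add E P Q : on_curve E P -> on_curve E Q -> on_curve E (wadd E P Q).
Proof.
case: P => [[x1 y1]|//]; case: Q => [[x2 y2]|//] hP hQ; rewrite /wadd.
(* [f] is the curve equation restricted to the line [y = l x + m]; the sum is the negative of the
   third intersection point. *)
have line l m x3 :
  let f x := x ^+ 3 + wa2 E * x ^+ 2 + wa4 E * x + wa6 E - ((l * x + m) ^+ 2
     + wa1 E * x * (l * x + m) + wa3 E * (l * x + m)) in
  f x3 = 0 -> on_curve E (Some (x3, - (l + wa1 E) * x3 - m - wa3 E)).
  move=> f f0; have -> : Some (x3, - (l + wa1 E) * x3 - m - wa3 E) =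
     wneg E (Some (x3, l * x3 + m)) by congr Some; congr pair; ring.
  by rewrite on_curve_neg /= eq_sym -subr_eq0; apply/eqP.
have [e|n12] := eqVneq x1 x2; last first.
  have d0 : x2 - x1 != 0 by rewrite subr_eq0 eq_sym.
  apply: line => //; move/eqP: hP; move/eqP: hQ => /= hQ hP.
  set l := (y2 - y1) / (x2 - x1); set x3 := l ^+ 2 + _ - _ - _ - _.
  have e2 : l * x2 + (y1 - l * x1) = y2 by rewrite /l; field.
  pose f x := x ^+ 3 + wa2 E * x ^+ 2 + wa4 E * x + wa6 E - ((l * x + (y1 - l * x1)) ^+ 2
     + wa1 E * x * (l * x + (y1 - l * x1)) + wa3 E * (l * x + (y1 - l * x1))).
  have f1 : f x1 = 0.
    by rewrite /f addrC -[l * x1 + _]addrC subrK -hP; ring.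
  have f2 : f x2 = 0 by rewrite /f e2 -hQ; ring.
  rewrite -/(f x3); apply: (mulfI d0); rewrite mulr0.
  (* [x3] is chosen so that the monic cubic [f] differs from [(x - x1)(x - x2)(x - x3)] by a linear
     polynomial, here interpolated from its values at [x1] and [x2]. *)
  have -> : (x2 - x1) * f x3 = f x2 * (x3 - x1) - f x1 * (x3 - x2) by rewrite /f /x3; ring.
  by rewrite f1 f2 !mul0r subr0.
subst x2; case: eqP => // /eqP n0 /=.
have e12 := on_curve_same_x hP hQ n0.
have {}n0 : 2%:R * y1 + wa1 E * x1 + wa3 E != 0 by move: n0; rewrite -e12 mulr_natl mulr2n.
apply: line => //; move/eqP: hP => /= hP.
set l := _ / _; set x3 := l ^+ 2 + _ - _ - _ - _.
have hl : l * (2%:R * y1 + wa1 E * x1 + wa3 E)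
   = 3%:R * x1 ^+ 2 + 2%:R * wa2 E * x1 + wa4 E - wa1 E * y1 by rewrite /l divfK.
pose F := y1 ^+ 2 + wa1 E * x1 * y1 + wa3 E * y1 - (x1 ^+ 3 + wa2 E * x1 ^+ 2 + wa4 E * x1 + wa6 E).
pose G := l * (2%:R * y1 + wa1 E * x1 + wa3 E)
   - (3%:R * x1 ^+ 2 + 2%:R * wa2 E * x1 + wa4 E - wa1 E * y1).
have F0 : F = 0 by rewrite /F hP subrr.
have G0 : G = 0 by rewrite /G hl subrr.
(* The same linear remainder for a double intersection: [-F] is the value and [-G] the derivative of
   the cubic at [x1]. *)
transitivity (- F - (x3 - x1) * G); last by rewrite F0 G0 mulr0 oppr0 addr0.
by rewrite /F /G /x3; ring.
Qed.

(* For [a3 = 0], the products of [x(P - Q)], [x(P + Q)] and [x(P - Q) * x(P + Q)]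
   with [(x1 - x2) ^+ 2]. *)
Definition diff_num (a1 a2 x1 y1 x2 y2 : K) : K :=
  (y1 + y2 + a1 * x2) * (y1 + y2 + a1 * x1) - (a2 + x1 + x2) * (x1 - x2) ^+ 2.
Definition sum_num (a1 a2 x1 y1 x2 y2 : K) : K :=
  (y1 - y2) ^+ 2 + a1 * (y1 - y2) * (x1 - x2) - (a2 + x1 + x2) * (x1 - x2) ^+ 2.
Definition prod_num (a1 a2 a4 a6 x1 x2 : K) : K :=
  x1 ^+ 2 * x2 ^+ 2 - 2%:R * a4 * x1 * x2 - 4%:R * a6 * (x1 + x2)
  - (a1 ^+ 2 * a6 + 4%:R * a2 * a6 - a4 ^+ 2).

(** For Q = -P the first relation degenerates to [0 = 0], while the second becomes the duplication
    formula and still determines [x3]. *)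
Lemma wsub_x a1 a2 a4 a6 x1 y1 x2 y2 :
  let E := WC a1 a2 0 a4 a6 in
  on_curve E (Some (x1, y1)) -> on_curve E (Some (x2, y2)) -> (x1, y1) <> (x2, y2) ->
  exists x3 y3, [/\ wadd E (Some (x1, y1)) (wneg E (Some (x2, y2))) = Some (x3, y3),
    x3 * (x1 - x2) ^+ 2 = diff_num a1 a2 x1 y1 x2 y2 &
    x3 * sum_num a1 a2 x1 y1 x2 y2 = prod_num a1 a2 a4 a6 x1 x2].
Proof.
move=> E hP hQ n12; have eP := eqP hP; have eQ := eqP hQ.
rewrite /= mul0r addr0 in eP; rewrite /= mul0r addr0 in eQ.
rewrite /wneg /wadd /diff_num /sum_num /prod_num.
have [e|x12] := eqVneq x1 x2; last first.
  have d0 : x2 - x1 != 0 by rewrite subr_eq0 eq_sym.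
  have d0' : x1 - x2 != 0 by rewrite subr_eq0.
  rewrite andFb; eexists; eexists; split; first by reflexivity.
    by rewrite /=; field.
  apply: (mulfI (expf_neq0 2 d0')).
  set S := (a2 + x1 + x2) * (x1 - x2) ^+ 2.
  (* The product of the numerators of x(P - Q) and x(P + Q) depends on the ordinates only through
     [y (y + a1 x)], which the curve equations turn into cubics in [x]; [H] is that dependence. *)
  pose H G1 G2 := (G1 + G2 - S) ^+ 2 + a1 ^+ 2 * x1 * x2 * (G1 + G2 - S) - 4%:R * G1 * G2
     - a1 ^+ 2 * (x1 ^+ 2 * G2 + x2 ^+ 2 * G1).
  transitivity (H (y1 ^+ 2 + a1 * x1 * y1) (y2 ^+ 2 + a1 * x2 * y2)).
    by rewrite /H /S /=; field.
  by rewrite eP eQ /H /S; ring.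
subst x2; have y12 : y1 - y2 != 0.
  by rewrite subr_eq0; apply/eqP => e; apply: n12; rewrite e.
have e2 : y2 = - y1 - a1 * x1.
  apply/eqP; rewrite -subr_eq0; apply/eqP.
  have [h|h] := eqVneq (y1 + y2 + wa1 E * x1 + wa3 E) 0.
    by rewrite -h /=; ring.
  by move: y12; rewrite (on_curve_same_x hP hQ h) subrr eqxx.
have n0 : 2%:R * y1 + a1 * x1 + 0 != 0.
  by apply: contraNneq y12 => h; rewrite e2 -h; apply/eqP; ring.
rewrite ifF; last first.
  rewrite ?eqxx /=; apply/negbTE; move: y12; rewrite (_ : _ + _ + _ + _ = y1 - y2) //; ring.
eexists; eexists; split; first by reflexivity.
  by rewrite subrr expr0n mulr0 /= e2; ring.
pose H G := (3%:R * x1 ^+ 2 + 2%:R * a2 * x1 + a4) ^+ 2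
  + a1 ^+ 2 * x1 * (3%:R * x1 ^+ 2 + 2%:R * a2 * x1 + a4) - a1 ^+ 2 * G
  - (a2 + 2%:R * x1) * (4%:R * G + a1 ^+ 2 * x1 ^+ 2).
transitivity (H (y1 ^+ 2 + a1 * x1 * y1)).
  by rewrite /H /= e2; rewrite addr0 in n0; field.
by rewrite eP /H; ring.
Qed.

End Difference.

(** * Index of E_0 for equations whose reduction is singular at the origin *)

Section Cusp.
Variables (K : fieldType) (v : K -> int) (p : nat).
Hypothesis Qp : is_Qp v p.
Notation vge := (Defs.vge v).
Notation veq := (veq v).
Variables a1 a2 a4 a6 : K.
Hypotheses (i1 : vge a1 0) (i2 : vge a2 0) (i4 : vge a4 1) (i6 : vge a6 1).
Let E := WC a1 a2 0 a4 a6.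

Lemma wintegral_singular : wintegral v E.
Proof. by split=> //=; [left | apply: vge_le i4 _ | apply: vge_le i6 _]. Qed.

Lemma on_curve_singular_y x y : on_curve E (Some (x, y)) -> vge x 1 -> vge y 1.
Proof.
move=> h hx; have hx0 : vge x 0 by apply: vge_le hx _.
have hy := wintegral_on_curve_y Qp wintegral_singular h hx0.
apply: (vge_sqr Qp); move/eqP: h => /=; rewrite mul0r addr0 => h.
have -> : y ^+ 2 = x ^+ 3 + a2 * x ^+ 2 + a4 * x + a6 - a1 * x * y by rewrite -h; ring.
vg Qp.
Qed.

(** If both partial derivatives [f], [g] vanish mod p, then so does [x^3], because on the curve
    [x^3 = x g - y f + a4 x + 2 a6]. The identity divides by nothing, so it applies at p = 2 and 3
    as well. *)
Lemma in_E0_singular x y : on_curve E (Some (x, y)) ->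
  in_E0 v E (Some (x, y)) <-> ~ vge x 1.
Proof.
move=> hP; apply: (iff_trans (in_E0P Qp _ _ wintegral_singular)) => /=.
rewrite addr0; split=> h.
  move=> hx; have hy := on_curve_singular_y hP hx; apply: h.
  have hx0 : vge x 0 by apply: vge_le hx _.
  have hy0 : vge y 0 by apply: vge_le hy _.
  by do !split=> //; vg Qp.
move=> [hx [hy [hf hg]]]; apply: h; apply: (vge_cube Qp).
move/eqP: hP => /=; rewrite mul0r addr0 => e.
set f := 2%:R * y + a1 * x in hf; set g := _ - a1 * y in hg.
have -> : x ^+ 3 = x * g - y * f + a4 * x + 2%:R * a6.
  have -> : a6 = y ^+ 2 + a1 * x * y - (x ^+ 3 + a2 * x ^+ 2 + a4 * x) by rewrite e; ring.
  by rewrite /f /g; ring.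
vg Qp.
Qed.

(* Only the identity component and the points reducing to the singular point matter: two points
   of the second kind are compared through the explicit abscissa of their difference. *)
Lemma has_index_of_spec (c : nat) (spec : 'I_c.+1 -> K -> K -> Prop) :
  (forall i x y, spec i x y -> on_curve E (Some (x, y)) /\ vge x 1) ->
  (forall i : 'I_c.+1, i != ord0 -> exists x y, spec i x y) ->
  (forall x y, on_curve E (Some (x, y)) -> vge x 1 -> exists2 i, i != ord0 & spec i x y) ->
  (forall i j x y, spec i x y -> spec j x y -> i = j) ->
  (forall i j x1 y1 x2 y2 x3, spec i x1 y1 -> spec j x2 y2 ->
     x3 * (x1 - x2) ^+ 2 = diff_num a1 a2 x1 y1 x2 y2 ->
     x3 * sum_num a1 a2 x1 y1 x2 y2 = prod_num a1 a2 a4 a6 x1 x2 ->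
     (vge x3 1 <-> i <> j)) ->
  has_index v E c.+1.
Proof.
move=> spec1 specE specC specU specD.
(* Index 0 is reserved for the identity component, represented by O. *)
pose S (i : 'I_c.+1) (P : wpoint K) :=
  if i == ord0 then P = None else exists2 q, P = Some q & spec i q.1 q.2.
have [reps hreps] : exists reps : 'I_c.+1 -> wpoint K, forall i, S i (reps i).
  apply: fin_all_exists => i; rewrite /S; have [_|i0] := eqVneq i ord0; first by exists None.
  by have [x [y h]] := specE i i0; exists (Some (x, y)); exists (x, y).
have cmp i j x1 y1 x2 y2 : spec i x1 y1 -> spec j x2 y2 ->
   in_E0 v E (wadd E (Some (x1, y1)) (wneg E (Some (x2, y2)))) <-> i = j.
  move=> h1 h2; have [c1 m1] := spec1 _ _ _ h1; have [c2 m2] := spec1 _ _ _ h2.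
  have [e|n12] := eqVneq (x1, y1) (x2, y2).
    case: e h2 => <- <- h2; split=> _; first exact: specU h1 h2.
    rewrite /wadd /wneg eqxx /= !addr0 subr0.
    by rewrite ifT //; apply/eqP; ring.
  have {}n12 : (x1, y1) <> (x2, y2) by apply/eqP.
  have [x3 [y3 [e3 h3 h4]]] := wsub_x c1 c2 n12.
  have c3 : on_curve E (Some (x3, y3)) by rewrite -e3 on_curve_add // on_curve_neg.
  have [d1 d2] := specD _ _ _ _ _ _ _ h1 h2 h3 h4.
  rewrite e3; apply: (iff_trans (in_E0_singular c3)).
  split=> [nx|ij /d1]; last by apply.
  by have [//|/eqP/d2] := eqVneq i j.
exists reps; split.
- move=> i; have := hreps i; rewrite /S; case: eqP => _; first by move=> ->.
  by move=> [[x y] -> /spec1 []].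
- move=> i j; have := hreps i; have := hreps j; rewrite /S.
  have [->|j0] := eqVneq j ord0; have [->|i0] := eqVneq i ord0 => //.
  + move=> -> [[x y] -> /spec1 [c1 m1]] h.
    by have [h' _] := in_E0_singular c1; case: (h' h).
  + move=> [[x y] -> /spec1 [c1 m1]] -> h.
    by have [h' _] := in_E0_singular (etrans (on_curve_neg E (Some (x, y))) c1); case: (h' h).
  by move=> [[x2 y2] -> h2] [[x1 y1] -> h1] /(cmp _ _ _ _ _ _ h1 h2).
move=> P hP; case: P hP => [[x y]|] hP.
  have [hx|[x0 xn]] := vge_dec v x 1; last first.
    exists ord0; have := hreps ord0; rewrite /S eqxx => -> /=.
    rewrite -/(in_E0 v E (Some _)); apply/(in_E0_singular hP) => -[e|]; last by lia.
    by rewrite e eqxx in x0.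
  have [i i0 hi] := specC _ _ hP hx; exists i; have := hreps i; rewrite /S (negPf i0).
  by move=> [[x2 y2] -> h2]; apply/(cmp _ _ _ _ _ _ hi h2).
by exists ord0; have := hreps ord0; rewrite /S eqxx => ->.
Qed.
End Cusp.

(** * Split nodes *)

Section SplitDifference.
Variables (K : fieldType) (v : K -> int) (p : nat).
Hypothesis Qp : is_Qp v p.
Notation vge := (Defs.vge v).
Notation veq := (veq v).
Variables (a c x1 x2 A1 A2 B1 B2 x3 : K) (N : int).
Hypotheses (ha : veq a 0) (hc : veq c N).
Hypotheses (ex1 : a * x1 = A2 - A1) (ex2 : a * x2 = B2 - B1).
Hypothesis ediff :
  x3 * (x1 - x2) ^+ 2 = A1 * B1 + A2 * B2 + 2%:R * c + x1 * x2 * (x1 + x2).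
Hypothesis esum :
  x3 * - (A1 * B2 + A2 * B1 - 2%:R * c - x1 * x2 * (x1 + x2)) =
  x1 ^+ 2 * x2 ^+ 2 - 4%:R * c * (x1 + x2) - a ^+ 2 * c.

Lemma veq_unit_mul x m : veq (a * x) m -> veq x m.
Proof.
by move=> h; rewrite -(mulKf ha.1 x) -[m]add0r -[X in X + _]oppr0; apply: (veqM Qp (veqV Qp ha)).
Qed.

Lemma vge_unit_mul x m : vge (a * x) m -> vge x m.
Proof. by move=> h; have := vge_mulr_cancel Qp ha (x := x); rewrite mulrC => /(_ m h); rewrite subr0. Qed.

(** [A1], [A2] stand for the factors [y] and [y + a x] of the first point, [B1], [B2] for those of
    the second, in either order. Their difference is [x] up to a unit, so the factor of smaller
    valuation fixes [v x]. *)
Lemma veq_near k : veq A1 k -> vge A2 (k + 1) -> veq x1 k.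
Proof. by move=> h1 h2; apply: veq_unit_mul; rewrite ex1 addrC; apply: (veqD Qp (veqN Qp h1)). Qed.

Lemma veq_near' k : veq B1 k -> vge B2 (k + 1) -> veq x2 k.
Proof. by move=> h1 h2; apply: veq_unit_mul; rewrite ex2 addrC; apply: (veqD Qp (veqN Qp h1)). Qed.

Lemma veq_near_opp k : veq B2 k -> vge B1 (k + 1) -> veq x2 k.
Proof. by move=> h1 h2; apply: veq_unit_mul; rewrite ex2; apply: (veqD Qp h1); apply: (vgeN Qp). Qed.

Lemma vge_x3_of_distinct (x y : K) k : x1 - x2 = x + y -> veq x k -> vge y (k + 1) ->
  vge (A1 * B1 + A2 * B2 + 2%:R * c + x1 * x2 * (x1 + x2)) (2 * k + 1) -> vge x3 1.
Proof.
move=> e hx hy hn; have hd : veq (x1 - x2) k by rewrite e; apply: (veqD Qp).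
apply: vge_le (vge_mulr_cancel Qp (veqX Qp 2 hd) _) _; first by rewrite ediff; apply: hn.
by lia.
Qed.

(** If [k < l], the denominator [(x1 - x2)^2] has valuation exactly [2 k] and the numerator at least
    [k + l]; symmetrically if [l < k]. If [k = l], the term [A1 * B1] gives the numerator valuation
    exactly [2 k], which the denominator attains or exceeds. *)
Lemma split_same_side k l : 0 < k -> 0 < l -> 2 * k < N -> 2 * l < N ->
  veq A1 k -> vge A2 (k + 1) -> veq B1 l -> vge B2 (l + 1) -> vge x3 1 <-> k != l.
Proof.
move=> k0 l0 hk hl hA1 hA2 hB1 hB2; have hx1 := veq_near hA1 hA2; have hx2 := veq_near' hB1 hB2.
have hn : vge (A2 * B2 + 2%:R * c + x1 * x2 * (x1 + x2)) (k + l + 1).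
  have hxx : vge (x1 + x2) 1 by vg Qp.
  by vg Qp.
have [kl|lk|kl] := ltgtP k l.
- split=> // _; apply: (vge_x3_of_distinct (x := x1) (y := - x2) (k := k)) => //; first by vg Qp.
  rewrite -!addrA; apply: (vgeD Qp); first by vg Qp.
  by rewrite !addrA; apply: vge_le hn _; lia.
- split=> // _; apply: (vge_x3_of_distinct (x := - x2) (y := x1) (k := l)) => //.
  + by rewrite addrC.
  + exact: (veqN Qp).
  + by vg Qp.
  rewrite -!addrA; apply: (vgeD Qp); first by vg Qp.
  by rewrite !addrA; apply: vge_le hn _; lia.
split=> // h3; subst l.
have hnum : veq (A1 * B1 + A2 * B2 + 2%:R * c + x1 * x2 * (x1 + x2)) (k + k).
  by rewrite -!addrA; apply: (veqD Qp (veqM Qp hA1 hB1)); rewrite !addrA; apply: hn.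
have hd : vge (x1 - x2) k by vg Qp.
have : vge (A1 * B1 + A2 * B2 + 2%:R * c + x1 * x2 * (x1 + x2)) (k + k + 1).
  by rewrite -ediff; vg Qp.
by move/(veq_vge_le hnum); lia.
Qed.

(** For [k = l] the difference [x1 - x2] may be arbitrarily small. The sum numerator is then used:
    [A1 * B2] gives it valuation exactly [2 k], while the product numerator is divisible by p^(2k+1)
    since [2 k < N]. *)
Lemma split_opposite_sides k l : 0 < k -> 0 < l -> 2 * k < N -> 2 * l < N ->
  veq A1 k -> vge A2 (k + 1) -> vge B1 (l + 1) -> veq B2 l -> vge x3 1.
Proof.
move=> k0 l0 hk hl hA1 hA2 hB1 hB2; have hx1 := veq_near hA1 hA2; have hx2 := veq_near_opp hB2 hB1.
have hxx : vge (x1 + x2) 1 by vg Qp.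
have hn : vge (A1 * B1 + A2 * B2 + 2%:R * c + x1 * x2 * (x1 + x2)) (k + l + 1) by vg Qp.
have [kl|lk|kl] := ltgtP k l.
- apply: (vge_x3_of_distinct (x := x1) (y := - x2) (k := k)) => //; first by vg Qp.
  by apply: vge_le hn _; lia.
- apply: (vge_x3_of_distinct (x := - x2) (y := x1) (k := l)) => //.
  + by rewrite addrC.
  + exact: (veqN Qp).
  + by vg Qp.
  by apply: vge_le hn _; lia.
subst l.
have hs : veq (- (A1 * B2 + A2 * B1 - 2%:R * c - x1 * x2 * (x1 + x2))) (k + k).
  apply: (veqN Qp); rewrite -!addrA; apply: (veqD Qp (veqM Qp hA1 hB2)).
  by vg Qp.
apply: vge_le (vge_mulr_cancel Qp hs (m := k + k + 1) _) _; last by lia.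
by rewrite esum; vg Qp.
Qed.

Lemma split_middle_side k l : 0 < l -> 2 * k = N -> 2 * l < N ->
  veq A1 k -> veq A2 k -> veq B1 l -> vge B2 (l + 1) -> vge x3 1.
Proof.
move=> l0 hk hl hA1 hA2 hB1 hB2; have hx2 := veq_near' hB1 hB2.
have hx1 : vge x1 k by apply: vge_unit_mul; rewrite ex1; vg Qp.
have hxx : vge (x1 + x2) 1 by vg Qp.
apply: (vge_x3_of_distinct (x := - x2) (y := x1) (k := l)) => //.
- by rewrite addrC.
- exact: (veqN Qp).
- by vg Qp.
by vg Qp.
Qed.

(** The sum numerator is divisible by p^N, but the term [a^2 c] keeps the product numerator at
    valuation exactly N. *)
Lemma split_middle k : 0 < k -> 2 * k = N ->
  veq A1 k -> veq A2 k -> veq B1 k -> veq B2 k -> ~ vge x3 1.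
Proof.
move=> k0 hk hA1 hA2 hB1 hB2 h3.
have hx1 : vge x1 k by apply: vge_unit_mul; rewrite ex1; vg Qp.
have hx2 : vge x2 k by apply: vge_unit_mul; rewrite ex2; vg Qp.
have hxx : vge (x1 + x2) 1 by vg Qp.
have hs : vge (- (A1 * B2 + A2 * B1 - 2%:R * c - x1 * x2 * (x1 + x2))) (2 * k) by vg Qp.
have hM : veq (x1 ^+ 2 * x2 ^+ 2 - 4%:R * c * (x1 + x2) - a ^+ 2 * c) N.
  rewrite addrC; apply: (veqD Qp); last by vg Qp.
  by apply: (veqN Qp); have := veqM Qp (veqX Qp 2 ha) hc; rewrite mul0r add0r.
have : vge (x1 ^+ 2 * x2 ^+ 2 - 4%:R * c * (x1 + x2) - a ^+ 2 * c) (N + 1).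
  by rewrite -esum; vg Qp.
by move/(veq_vge_le hM); lia.
Qed.

End SplitDifference.

Section SplitNode.
Variables (K : fieldType) (v : K -> int) (p : nat).
Hypothesis Qp : is_Qp v p.
Notation vge := (Defs.vge v).
Notation veq := (veq v).
Variables (a c : K) (N : nat).
Hypotheses (ha : veq a 0) (hc : veq c N).
Let E := WC a 0 0 0 c.

Lemma split_curveE x y : on_curve E (Some (x, y)) <-> y * (y + a * x) = x ^+ 3 + c.
Proof.
rewrite /=; split=> [/eqP h|h]; last apply/eqP.
  by have -> : x ^+ 3 + c = x ^+ 3 + 0 * x ^+ 2 + 0 * x + c by [ring]; rewrite -h; ring.
have -> : x ^+ 3 + 0 * x ^+ 2 + 0 * x + c = x ^+ 3 + c by ring.
by rewrite -h; ring.
Qed.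

(* The components of the special fibre other than the identity: for [2 * i < N] the points close
   to the branch [y + a * x = 0] of the node, for [2 * i > N] their opposites. *)
Definition split_component (i : nat) (x y : K) : Prop :=
  [\/ [/\ (0 < i)%N, (2 * i < N)%N, veq y i & vge (y + a * x) (i%:Z + 1)],
      [/\ (i < N)%N, (N < 2 * i)%N, veq (y + a * x) (N%:Z - i%:Z) & vge y (N%:Z - i%:Z + 1)]
    | [/\ (0 < i)%N, (2 * i = N)%N, veq y i & veq (y + a * x) i]].

Lemma split_component_lt i x y : split_component i x y -> (0 < i < N)%N.
Proof. by case=> [[? ? _ _]|[? ? _ _]|[? ? _ _]]; lia. Qed.

Lemma split_component_x i x y : split_component i x y -> vge x 1.
Proof.
move=> h; apply: (vge_unit_mul Qp ha); have -> : a * x = (y + a * x) - y by ring.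
rewrite /split_component in h; set z := y + a * x in h *.
by case: h => [[h0 h1 h2 h3]|[h0 h1 h2 h3]|[h0 h1 h2 h3]]; vg Qp.
Qed.

(** For [k] below N/2, put [x = pi^k] and [y = pi^k (z - a)]: the equation becomes
    [z (z - a) = pi^k + c / pi^(2k)], whose right side is divisible by p, and Hensel gives the root
    near 0. *)
Lemma split_component_exists i : prime p -> (0 < i < N)%N ->
  exists x y, on_curve E (Some (x, y)) /\ split_component i x y.
Proof.
move=> p_pr iN.
have hpi := veq_pi Qp p_pr; set pi := p%:R in hpi; have pi0 := hpi.1.
have small k : (0 < k)%N -> (2 * k < N)%N -> exists z, [/\ vge z 1,
    (pi ^+ k * z) * (pi ^+ k * (z - a)) = (pi ^+ k) ^+ 3 + c & veq (z - a) 0].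
  move=> k0 kN; have hk := veqX Qp k hpi.
  have [z hz ez] : exists2 z, vge z 1 &
      - (pi ^+ k + c / (pi ^+ k) ^+ 2) + (- a) * z + 1 * z ^+ 2 = 0.
    apply: (quadratic_hensel Qp) => //; first exact: (vge_one Qp).
      exact: (veqN Qp ha).
    have h2 : vge (c / (pi ^+ k) ^+ 2) 1.
      by apply: (vge_divr Qp (veqX Qp 2 hk) (veq_vge hc)); lia.
    by vg Qp.
  exists z; split=> //; last first.
    by rewrite addrC; apply: (veqD Qp (veqN Qp ha)).
  have -> : c = (c / (pi ^+ k) ^+ 2) * (pi ^+ k) ^+ 2 by rewrite divfK // expf_neq0 // hk.1.
  apply/eqP; rewrite -subr_eq0; apply/eqP; rewrite -[RHS](mulr0 ((pi ^+ k) ^+ 2)) -ez; ring.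
have [h|h|h] := ltngtP (2 * i)%N N.
- have [z [hz e hza]] := small i (ltac:(lia)) h; have hk := veqX Qp i hpi.
  exists (pi ^+ i), (pi ^+ i * (z - a)); split.
    by apply/split_curveE; rewrite -e; ring.
  apply: Or31; split; [lia | by [] | |].
    by have := veqM Qp hk hza; rewrite mul1r addr0.
  have -> : pi ^+ i * (z - a) + a * pi ^+ i = pi ^+ i * z by ring.
  vg Qp.
(* The opposite of the point built for [N - i]. *)
- have [z [hz e hza]] := small (N - i)%N (ltac:(lia)) (ltac:(lia)); have hk := veqX Qp (N - i)%N hpi.
  exists (pi ^+ (N - i)), (- (pi ^+ (N - i) * z)); split.
    by apply/split_curveE; rewrite -e; ring.
  apply: Or32; split; [lia | lia | |].
    have -> : - (pi ^+ (N - i) * z) + a * pi ^+ (N - i) = - (pi ^+ (N - i) * (z - a)) by ring.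
    have := veqN Qp (veqM Qp hk hza); rewrite mul1r addr0.
    by have -> : (N - i)%N%:Z = N%:Z - i%:Z by lia.
  by vg Qp.
have hk := veqX Qp i hpi; rewrite mul1r in hk.
(* For [2 i = N], put [y = pi^i] and [x = pi^i (x0 + z)]. Dividing by [pi^(2i)] leaves
   [1 + a (x0 + z) = w + pi^i (x0 + z)^3]; [x0] solves this mod p and [z] is the Hensel
   correction. *)
pose w := c / (pi ^+ i) ^+ 2.
have hw : veq w 0.
  have := veqM Qp hc (veqV Qp (veqX Qp 2 hk)).
  by have -> : N%:Z - i%:Z * 2%:Z = 0 by lia.
pose x0 := (w - 1) / a.
have hx0 : vge x0 0 by apply: (vgeVu Qp ha); vg Qp.
have [z hz ez] : exists2 z, vge z 1 & (- (pi ^+ i * x0 ^+ 3)) + (a - 3%:R * pi ^+ i * x0 ^+ 2) * z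
    + (- (3%:R * pi ^+ i * x0)) * z ^+ 2 + (- pi ^+ i) * z ^+ 3 = 0.
  apply: (cubic_hensel Qp); [by vg Qp | | by vg Qp | by vg Qp].
  by apply: (veqD Qp ha); vg Qp.
have e : pi ^+ i * (pi ^+ i + a * (pi ^+ i * (x0 + z))) = (pi ^+ i * (x0 + z)) ^+ 3 + c.
  have -> : c = (1 + a * x0) * (pi ^+ i) ^+ 2.
    by rewrite /x0 [a * _]mulrC divfK ?ha.1 // addrC subrK /w divfK // expf_neq0 // hk.1.
  apply/eqP; rewrite -subr_eq0; apply/eqP; rewrite -[RHS](mulr0 ((pi ^+ i) ^+ 2)) -ez; ring.
exists (pi ^+ i * (x0 + z)), (pi ^+ i); split; first exact/split_curveE.
apply: Or33; split=> //; first by lia.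
have hz0 : vge (x0 + z) 0 by vg Qp.
have hp : veq (pi ^+ i * (pi ^+ i + a * (pi ^+ i * (x0 + z)))) N.
  by rewrite e addrC; apply: (veqD Qp hc); vg Qp.
have := veqM Qp hp (veqV Qp hk); rewrite mulrAC mulfV ?hk.1 // mul1r.
by have -> : N%:Z - i%:Z = i by lia.
Qed.

(** When the factors [y] and [z = y + a x] have different valuations, the smaller one is [v x = k],
    and [c = y z - x^3] is divisible by p^(2k+1), so [2 k < N]. When both equal [k], the cube is
    negligible against [y z] and [2 k = N]. *)
Lemma split_component_cover x y : (0 < N)%N -> on_curve E (Some (x, y)) -> vge x 1 ->
  exists i, split_component i x y.
Proof.
move=> N0 /[dup] hP /split_curveE e hx.
have i0 : vge (0 : K) 1 by left.
have hc1 : vge c 1 by vg Qp.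
have iE : wintegral v E by split=> /=; [exact: veq_vge | left | left | left | vg Qp].
have hy := on_curve_singular_y Qp (veq_vge ha) (vge0 v 0) i0 hc1 hP hx.
have hxy : vge (y + a * x) 1 by vg Qp.
set z := y + a * x in e hxy *.
have ex : a * x = z - y by rewrite /z; ring.
have near (A B : K) k : A * B = x ^+ 3 + c -> veq x k -> veq A k -> vge B (k + 1) -> 2 * k < N%:Z.
  move=> eAB hxk hA hB; have k1 := veq_vge_le hxk hx.
  have : vge c (2 * k + 1).
    have -> : c = A * B - x ^+ 3 by rewrite eAB; ring.
    by vg Qp.
  by move/(veq_vge_le hc); lia.
have rel k : 0 < k -> veq y k -> veq z k -> 2 * k = N%:Z.
  move=> k0 h1 h2.
  have hxk : vge x k by apply: (vge_unit_mul Qp ha); rewrite ex; vg Qp.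
  have h : veq (x ^+ 3 + c) (k + k) by rewrite -e; apply: (veqM Qp).
  have h' : veq c (k + k).
    by rewrite -(addrK (x ^+ 3) c) [c + _]addrC; apply: (veqD Qp) => //; vg Qp.
  by have := veq_inj h' hc; lia.
have toN (k : int) : 0 < k -> exists2 k' : nat, k = k'%:Z & (0 < k')%N.
  by case: k => // k; exists k.
have side1 k : veq y k -> vge z (k + 1) -> exists i, split_component i x y.
  move=> h1 h2; have hxk : veq x k by apply: (veq_near Qp ha ex h1 h2).
  have [k' ? k'0] := toN k (veq_vge_le h1 hy); subst k.
  exists k'; apply: Or31; split=> //.
  by have := near _ _ _ e hxk h1 h2; lia.
have side2 k : veq z k -> vge y (k + 1) -> exists i, split_component i x y.
  move=> h1 h2; have hxk : veq x k.
    by apply: (veq_unit_mul Qp ha); rewrite ex; apply: (veqD Qp h1); apply: (vgeN Qp).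
  have [k' ? k'0] := toN k (veq_vge_le h1 hxy); subst k.
  have kN := near _ _ _ (etrans (mulrC _ _) e) hxk h1 h2.
  by exists (N - k')%N; apply: Or32; split; (try lia); rewrite -/z;
    have -> : N%:Z - (N - k')%N%:Z = k' by lia.
(* A vanishing [y] is treated apart, since [v] carries no information at 0. *)
have [y0|y0] := eqVneq y 0.
  have z0 : z != 0.
    apply/negP => /eqP z0; have x0 : x = 0.
      by apply: (mulfI ha.1); rewrite ex z0 y0 subr0 mulr0.
    by have := hc.1; rewrite (_ : c = 0) ?eqxx //; move: e; rewrite y0 mul0r x0 expr0n add0r.
  by apply: (side2 (v z)) => //; rewrite y0; left.
have [h|[z0 h]] := vge_dec v z (v y + 1); first exact: (side1 (v y)).
have [h'|[_ h']] := vge_dec v y (v z + 1); first exact: (side2 (v z)).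
have yz : v z = v y by lia.
have hyk := veq_val v y0; have hzk := veq_val v z0; rewrite yz in hzk.
have [k' ek k'0] := toN (v y) (veq_vge_le hyk hy); rewrite ek in hyk hzk.
exists k'; apply: Or33; split=> //.
by have := rel k' _ hyk hzk; lia.
Qed.

Lemma split_component_inj i j x y : split_component i x y -> split_component j x y -> i = j.
Proof.
by case=> [[h1 h2 h3 h4]|[h1 h2 h3 h4]|[h1 h2 h3 h4]];
   case=> [[k1 k2 k3 k4]|[k1 k2 k3 k4]|[k1 k2 k3 k4]];
   try (have := veq_inj h3 k3); try (have := veq_inj h3 k4);
   try (have := veq_inj h4 k3); try (have := veq_vge_le h3 k4);
   try (have := veq_vge_le k3 h4); try (have := veq_vge_le h4 k4);
   try (have := veq_vge_le k4 h4); lia.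
Qed.

(** The nine cases reduce to the four configurations above through two symmetries: swapping the
    factors [y] and [y + a x], which replaces [a] by [-a], and exchanging the two points, which
    preserves x(P - Q). *)
Lemma split_component_diff i j x1 y1 x2 y2 x3 :
  split_component i x1 y1 -> split_component j x2 y2 ->
  x3 * (x1 - x2) ^+ 2 = diff_num a 0 x1 y1 x2 y2 ->
  x3 * sum_num a 0 x1 y1 x2 y2 = prod_num a 0 0 c x1 x2 ->
  on_curve E (Some (x1, y1)) -> on_curve E (Some (x2, y2)) ->
  vge x3 1 <-> i <> j.
Proof.
move=> hi hj e1 e2 /split_curveE c1 /split_curveE c2.
set A2 := y1 + a * x1 in c1; set B2 := y2 + a * x2 in c2.
have f1 : a * x1 = A2 - y1 by rewrite /A2; ring.
have f2 : a * x2 = B2 - y2 by rewrite /B2; ring.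
have g1 : - a * x1 = y1 - A2 by rewrite /A2; ring.
have g2 : - a * x2 = y2 - B2 by rewrite /B2; ring.
have ed : x3 * (x1 - x2) ^+ 2 = y1 * y2 + A2 * B2 + 2%:R * c + x1 * x2 * (x1 + x2).
  have -> : 2%:R * c = (y1 * A2 - x1 ^+ 3) + (y2 * B2 - x2 ^+ 3) by rewrite c1 c2; ring.
  by rewrite e1 /diff_num /A2 /B2; ring.
have es : x3 * - (y1 * B2 + A2 * y2 - 2%:R * c - x1 * x2 * (x1 + x2)) =
  x1 ^+ 2 * x2 ^+ 2 - 4%:R * c * (x1 + x2) - a ^+ 2 * c.
  transitivity (prod_num a 0 0 c x1 x2); last by rewrite /prod_num; ring.
  have -> : 2%:R * c = (y1 * A2 - x1 ^+ 3) + (y2 * B2 - x2 ^+ 3) by rewrite c1 c2; ring.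
  by rewrite -e2 /sum_num /A2 /B2; ring.
have ed' : x3 * (x1 - x2) ^+ 2 = A2 * B2 + y1 * y2 + 2%:R * c + x1 * x2 * (x1 + x2).
  by rewrite ed; ring.
have es' : x3 * - (A2 * y2 + y1 * B2 - 2%:R * c - x1 * x2 * (x1 + x2)) =
  x1 ^+ 2 * x2 ^+ 2 - 4%:R * c * (x1 + x2) - (- a) ^+ 2 * c.
  by rewrite sqrrN -es; ring.
have fl (h : x3 * (x1 - x2) ^+ 2 = y1 * y2 + A2 * B2 + 2%:R * c + x1 * x2 * (x1 + x2)) :
   x3 * (x2 - x1) ^+ 2 = y2 * y1 + B2 * A2 + 2%:R * c + x2 * x1 * (x2 + x1).
  by rewrite -[x2 - x1]opprB sqrrN h; ring.
have fl' (h : x3 * (x1 - x2) ^+ 2 = A2 * B2 + y1 * y2 + 2%:R * c + x1 * x2 * (x1 + x2)) :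
   x3 * (x2 - x1) ^+ 2 = B2 * A2 + y2 * y1 + 2%:R * c + x2 * x1 * (x2 + x1).
  by rewrite -[x2 - x1]opprB sqrrN h; ring.
have ha' := veqN Qp ha.
case: hi => [[h1 h2 h3 h4]|[h1 h2 h3 h4]|[h1 h2 h3 h4]];
   case: hj => [[k1 k2 k3 k4]|[k1 k2 k3 k4]|[k1 k2 k3 k4]].
- have h := split_same_side Qp ha hc f1 f2 ed (k := i) (l := j) _ _ _ _ h3 h4 k3 k4.
  by rewrite h; [split=> [/eqP|ij]; [|apply/eqP] | | | |]; lia.
- split=> _; first by lia.
  by apply: (split_opposite_sides Qp ha hc f1 f2 ed es (k := i) (l := N%:Z - j%:Z)) => //; lia.
- split=> _; first by lia.
  by apply: (split_middle_side Qp ha hc f2 f1 (fl ed) (k := j) (l := i)) => //; lia.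
- split=> _; first by lia.
  by apply: (split_opposite_sides Qp ha' hc g1 g2 ed' es' (k := N%:Z - i%:Z) (l := j)) => //; lia.
- have h := split_same_side Qp ha' hc g1 g2 ed' (k := N%:Z - i%:Z) (l := N%:Z - j%:Z) _ _ _ _ h3 h4 k3 k4.
  by rewrite h; [split=> [/eqP|ij]; [|apply/eqP] | | | |]; lia.
- split=> _; first by lia.
  by apply: (split_middle_side Qp ha' hc g2 g1 (fl' ed') (k := j) (l := N%:Z - i%:Z)) => //; lia.
- split=> _; first by lia.
  by apply: (split_middle_side Qp ha hc f1 f2 ed (k := i) (l := j)) => //; lia.
- split=> _; first by lia.
  by apply: (split_middle_side Qp ha' hc g1 g2 ed' (k := i) (l := N%:Z - j%:Z)) => //; lia.
split=> [h|]; last by lia.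
have ij : j = i by lia.
subst j; case: (split_middle Qp ha hc f1 f2 es (k := i) _ _ h3 h4 k3 k4 h); lia.
Qed.

End SplitNode.

(** * Nonsplit nodes and cusps *)

(** Pigeonhole: for [i], [j] from 0 to (p - 1)/2, the residues of [i^2] are distinct, and so are
    those of [d j^2 + g]. These are p + 1 values in a set of p residues, so one of each kind
    coincide. *)
Lemma binary_form_represents (p d g : nat) : prime p -> odd p -> ~~ (p %| d)%N ->
  exists i j : nat, (p%:Z %| i%:Z ^+ 2 - d%:Z * j%:Z ^+ 2 - g%:Z)%Z.
Proof.
move=> p_pr p_odd pd; have p0 := prime_gt0 p_pr.
have euclid (x y : int) : (p%:Z %| x * y)%Z -> (p%:Z %| x)%Z || (p%:Z %| y)%Z.
  by rewrite !dvdzE abszM Euclid_dvdM.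
pose h := p./2; have ph : p = h.*2.+1 by rewrite /h -[in LHS](odd_double_half p) p_odd.
have sq_inj (i j : 'I_h.+1) : (p%:Z %| i%:Z ^+ 2 - j%:Z ^+ 2)%Z -> i = j.
  have -> : i%:Z ^+ 2 - j%:Z ^+ 2 = (i%:Z - j%:Z) * (i%:Z + j%:Z) by ring.
  have hi := ltn_ord i; have hj := ltn_ord j.
  move/euclid => h1; apply/val_inj/eqP; apply: contraLR h1 => /eqP /= ij.
  have small (z : int) : z != 0 -> (`|z| < p)%N -> ~~ (p%:Z %| z)%Z.
    by move=> z0 zp; rewrite dvdzE gtnNdvd //; lia.
  move: (nat_of_ord i) (nat_of_ord j) hi hj ij => i' j' hi hj ij.
  by rewrite negb_or !small //; lia.
pose f (i : 'I_h.+1) : 'I_p := Ordinal (ltn_pmod (i ^ 2) p0).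
pose g' (i : 'I_h.+1) : 'I_p := Ordinal (ltn_pmod (d * i ^ 2 + g) p0).
have fE (i j : nat) : (i %% p = j %% p)%N -> (p%:Z %| i%:Z - j%:Z)%Z.
  by move=> e; rewrite -eqz_mod_dvd !modz_nat e.
have sqz (n : nat) : (n ^ 2)%N%:Z = n%:Z ^+ 2 by rewrite -mulnn PoszM expr2.
have [/existsP[i /existsP[j /eqP[/fE e]]]|no] := boolP [exists i, [exists j, f i == g' j]].
  exists i, j; move: e; by rewrite PoszD PoszM !sqz opprD addrA.
pose F (s : 'I_h.+1 + 'I_h.+1) := match s with inl i => f i | inr j => g' j end.
have F_inj : injective F.
  have dj i j : f i <> g' j.
    by move=> e; case/negP: no; apply/existsP; exists i; apply/existsP; exists j; apply/eqP.
  move=> [i|i] [j|j] //= e.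
  - by congr inl; apply: sq_inj; case: e => /fE; rewrite !sqz.
  - by case: (dj _ _ e).
  - by case: (dj _ _ (esym e)).
  congr inr; apply: sq_inj; case: e => /fE; rewrite !PoszD !PoszM.
  have -> : d%:Z * (i ^ 2)%N%:Z + g%:Z - (d%:Z * (j ^ 2)%N%:Z + g%:Z) = d%:Z * (i%:Z ^+ 2 - j%:Z ^+ 2).
    by rewrite !sqz; ring.
  by case/euclid/orP => //; rewrite dvdzE /= (negPf pd).
by have := leq_card F F_inj; rewrite card_sum !card_ord; lia.
Qed.

Section SmallIndex.
Variables (K : fieldType) (v : K -> int) (p : nat).
Hypothesis Qp : is_Qp v p.
Notation vge := (Defs.vge v).
Notation veq := (veq v).

Lemma has_index_split a c (N : nat) : prime p -> veq a 0 -> veq c N -> (0 < N)%N ->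
  has_index v (WC a 0 0 0 c) N.
Proof.
move=> p_pr; case: N => [|n] // ha hc N0; have i0 : vge (0 : K) 1 by left.
have hc1 : vge c 1 by vg Qp.
apply: (has_index_of_spec Qp (veq_vge ha) (vge0 v 0) i0 hc1
  (spec := fun i x y => on_curve (WC a 0 0 0 c) (Some (x, y)) /\ split_component v a n.+1 i x y)).
- by move=> i x y [h1 h2]; split=> //; apply: (split_component_x Qp ha h2).
- move=> i i0'; apply: (split_component_exists Qp ha hc p_pr); rewrite ltn_ord andbT lt0n.
  exact: i0'.
- move=> x y hP hx; have [i hi] := split_component_cover Qp ha hc N0 hP hx.
  have /andP[i1 i2] := split_component_lt hi.
  by exists (Ordinal i2) => //; rewrite -val_eqE /= -lt0n.
- by move=> i j x y [_ h1] [_ h2]; apply: val_inj; apply: (split_component_inj h1 h2).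
move=> i j x1 y1 x2 y2 x3 [c1 h1] [c2 h2] e1 e2.
apply: (iff_trans (split_component_diff Qp ha hc h1 h2 e1 e2 c1 c2)).
by split=> ij e; apply: ij; [rewrite e | apply: val_inj].
Qed.

Section Singular.
Variables a1 a2 a4 a6 : K.
Hypotheses (i1 : vge a1 0) (i2 : vge a2 0) (i4 : vge a4 1) (i6 : vge a6 1).
Let E := WC a1 a2 0 a4 a6.

Lemma has_index1 : (forall x y, on_curve E (Some (x, y)) -> ~ vge x 1) -> has_index v E 1.
Proof.
move=> h; apply: (has_index_of_spec Qp i1 i2 i4 i6 (spec := fun _ _ _ => False)) => //.
- by move=> i; rewrite ord1.
- by move=> x y /h.
Qed.

(** If x(P - Q) were divisible by p, the relation [x3 * sum_num = prod_num] would make [prod_num]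
    divisible by p^(m+1). Hence all points with singular reduction form a single coset. *)
Lemma has_index2 m :
  (exists x y, on_curve E (Some (x, y)) /\ vge x 1) ->
  (forall x1 y1 x2 y2, on_curve E (Some (x1, y1)) -> on_curve E (Some (x2, y2)) ->
     vge x1 1 -> vge x2 1 ->
     vge (sum_num a1 a2 x1 y1 x2 y2) m /\ veq (prod_num a1 a2 a4 a6 x1 x2) m) ->
  has_index v E 2.
Proof.
move=> [x0 [y0 h0]] h.
have ord2 (i j : 'I_2) : i != ord0 -> j != ord0 -> i = j.
  by move=> i0 j0; apply: val_inj; move: i0 j0; case: i j => [[|[|]]] // ? [[|[|]]].
apply: (has_index_of_spec Qp i1 i2 i4 i6 (spec := fun i x y =>
  i != ord0 /\ (on_curve E (Some (x, y)) /\ vge x 1))).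
- by move=> i x y [].
- by move=> i hi; exists x0, y0.
- by move=> x y h1 h2; exists ord_max.
- by move=> i j x y [? _] [? _]; apply: ord2.
move=> i j x1 y1 x2 y2 x3 [hi [c1 m1]] [hj [c2 m2]] _ e.
split=> [h3|]; last by case; apply: ord2.
have [hs hp] := h _ _ _ _ c1 c2 m1 m2.
have : vge (prod_num a1 a2 a4 a6 x1 x2) (1 + m) by rewrite -e; apply: (vgeM Qp).
by move/(veq_vge_le hp); lia.
Qed.

End Singular.

(** * Nonsplit nodes, for odd p *)

Section NonsplitNode.
Variables (d c : K) (N : nat).
Hypotheses (p_pr : prime p) (p_odd : odd p).
Hypotheses (hd : veq d 0) (d_nonsquare : forall z, vge z 0 -> ~ vge (z ^+ 2 - d) 1).
Hypotheses (hc : veq c N) (N0 : (0 < N)%N).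
Let E := WC 0 d 0 0 c.

Lemma veq_two : veq (2%:R : K) 0.
Proof.
apply: (veq_nat0 Qp p_pr); apply/negP => /dvdn_leq => /(_ isT); have := prime_gt1 p_pr.
by move: p_odd; case: (p) => [|[|[|]]].
Qed.

Lemma nonsplit_curveE x y : on_curve E (Some (x, y)) <-> y ^+ 2 - d * x ^+ 2 = x ^+ 3 + c.
Proof.
rewrite /= !mul0r !addr0; split=> [/eqP->|h]; first by ring.
by apply/eqP; have -> : x ^+ 3 + d * x ^+ 2 + c = x ^+ 3 + c + d * x ^+ 2 by [ring]; rewrite -h; ring.
Qed.

(** This is the norm form of an unramified quadratic extension. Dividing by the coordinate of
    smaller valuation leaves a unit, as [d] is not a square mod p; [k] is that smaller valuation. *)
Lemma anisotropic x y : (x, y) != (0, 0) ->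
  exists k, [/\ veq (y ^+ 2 - d * x ^+ 2) (2 * k), vge x k & vge y k].
Proof.
move=> xy0; have [x0|x0] := eqVneq x 0.
  have y0 : y != 0 by apply: contraNneq xy0 => ->; rewrite x0.
  exists (v y); split; [|by rewrite x0; left | by right].
  rewrite x0 expr0n mulr0 subr0 mulrC; apply: (veqX Qp 2); exact: veq_val.
have hx := veq_val v x0.
have [hy|[y0 hy]] := vge_dec v y (v x).
  exists (v x); split=> //; last by right.
  have hz : vge (y / x) 0 by apply: (vge_divr Qp hx hy); rewrite subrr.
  have hu : veq ((y / x) ^+ 2 - d) 0.
    have h : vge ((y / x) ^+ 2 - d) 0 by vg Qp.
    by have [//|/(d_nonsquare hz)] := vge_cases h.
  have -> : y ^+ 2 - d * x ^+ 2 = ((y / x) ^+ 2 - d) * x ^+ 2 by field.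
  have := veqM Qp hu (veqX Qp 2 hx).
  by have -> : 0 + v x * 2%:Z = 2 * v x by lia.
have hyv := veq_val v y0.
exists (v y); split; [|by right; lia| by right].
by rewrite [2 * _]mulrC; apply: (veqD Qp (veqX Qp 2 hyv)); vg Qp.
Qed.

(** The norm [y^2 - d x^2] has valuation [2 k] and [x^3] at least [3 k], so [v c = 2 k]; an odd N
    leaves no such point. *)
Lemma nonsplit_singular_point x y : on_curve E (Some (x, y)) -> vge x 1 ->
  exists k : nat, [/\ N = (2 * k)%N, vge x k & vge y k].
Proof.
move=> /[dup] hP /nonsplit_curveE e hx.
have i0 : vge (0 : K) 1 by left.
have hc1 : vge c 1 by vg Qp.
have hy := on_curve_singular_y Qp (vge0 v 0) (veq_vge hd) i0 hc1 hP hx.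
have xy0 : (x, y) != (0, 0).
  apply/eqP => -[x0 y0]; have := hc.1; rewrite (_ : c = 0) ?eqxx //.
  by move: e; rewrite x0 y0 !expr0n mulr0 subr0 add0r.
have [k [h hxk hyk]] := anisotropic xy0.
have k1 : 1 <= k.
  have h2 : vge (y ^+ 2 - d * x ^+ 2) 2 by vg Qp.
  by have := veq_vge_le h h2; lia.
have h' : veq c (2 * k).
  rewrite -(addrK (x ^+ 3) c) [c + _]addrC -e; apply: (veqD Qp h); vg Qp.
have kN := veq_inj h' hc.
by exists `|k|%N; split; [lia| |]; have -> : `|k|%N%:Z = k by lia.
Qed.

(** Scaling both coordinates by [pi^k] leaves [y1^2 - d x1^2 = g + pi^k x1^3] with [g] a unit. The
    norm form represents [g] mod p, and one coordinate of the solution is a unit; Hensel's lemma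
    lifts in that one. *)
Lemma nonsplit_singular_point_exists k : N = (2 * k)%N ->
  exists x y, on_curve E (Some (x, y)) /\ vge x 1.
Proof.
move=> eN; have k0 : (0 < k)%N by lia.
have hpi := veq_pi Qp p_pr; set pi := p%:R in hpi; have hk := veqX Qp k hpi.
set q := pi ^+ k in hk; rewrite mul1r in hk; have q0 := hk.1.
pose g := c / q ^+ 2.
have hg : veq g 0.
  have := veqM Qp hc (veqV Qp (veqX Qp 2 hk)).
  by have -> : N%:Z - k%:Z * 2%:Z = 0 by lia.
have h2 := veq_two.
suff [x1 [y1 [hx1 e]]] : exists x1 y1, vge x1 0 /\ y1 ^+ 2 - d * x1 ^+ 2 = q * x1 ^+ 3 + g.
  exists (q * x1), (q * y1); split; last by vg Qp.
  apply/nonsplit_curveE; have -> : c = g * q ^+ 2 by rewrite /g divfK // expf_neq0.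
  transitivity (q ^+ 2 * (y1 ^+ 2 - d * x1 ^+ 2)); first by ring.
  by rewrite e; ring.
have [d' _ hd'] := residue Qp p_pr (veq_vge hd).
have [g' _ hg'] := residue Qp p_pr (veq_vge hg).
have pd : ~~ (p %| d')%N.
  apply/negP => h; have := elimT (vge_intP Qp p_pr d'%:Z) h => /(vgeD Qp hd').
  by rewrite /= subrK => /(veq_vge_le hd).
have [i [j hij]] := binary_form_represents g' p_pr p_odd pd.
have hc0 : vge (i%:R ^+ 2 - d * j%:R ^+ 2 - g) 1.
  have -> : i%:R ^+ 2 - d * j%:R ^+ 2 - g = (i%:Z ^+ 2 - d'%:Z * j%:Z ^+ 2 - g'%:Z)%:~R
     - (d - d'%:R) * j%:R ^+ 2 - (g - g'%:R).
    by rewrite !expr2 !rmorphB !rmorphM /=; ring.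
  have := elimT (vge_intP Qp p_pr _) hij => h.
  by vg Qp.
have hi0 : vge (i%:R : K) 0 by vg Qp.
have [hi|hi] := vge_cases hi0.
  have [z hz ez] : exists2 z, vge z 1 &
     (i%:R ^+ 2 - d * j%:R ^+ 2 - g - q * j%:R ^+ 3) + 2%:R * i%:R * z + 1 * z ^+ 2 = 0.
    apply: (quadratic_hensel Qp); first exact: (vge_one Qp).
      by have := veqM Qp h2 hi; rewrite add0r.
    by apply: (vgeB Qp) => //; vg Qp.
  exists j%:R, (i%:R + z); split; first by vg Qp.
  by apply/eqP; rewrite -subr_eq0 -ez; apply/eqP; ring.
have hj : veq (j%:R : K) 0.
  have hj0 : vge (j%:R : K) 0 by vg Qp.
  have [//|hj] := vge_cases hj0; have : vge g 1.
    have -> : g = i%:R ^+ 2 - d * j%:R ^+ 2 - (i%:R ^+ 2 - d * j%:R ^+ 2 - g) by ring.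
    by apply: (vgeB Qp) => //; vg Qp.
  by move/(veq_vge_le hg).
have [z hz ez] : exists2 z, vge z 1 &
    (i%:R ^+ 2 - d * j%:R ^+ 2 - g - q * j%:R ^+ 3)
    + (- (2%:R * d * j%:R) - 3%:R * q * j%:R ^+ 2) * z
    + (- d - 3%:R * q * j%:R) * z ^+ 2 + (- q) * z ^+ 3 = 0.
  apply: (cubic_hensel Qp); [by vg Qp | | | by vg Qp].
    apply: (veqD Qp); last by vg Qp.
    by apply: (veqN Qp); have := veqM Qp (veqM Qp h2 hd) hj; rewrite !add0r.
  by apply: (vgeB Qp) => //; vg Qp.
exists (j%:R + z), i%:R; split; first by vg Qp.
by apply/eqP; rewrite -subr_eq0 -ez; apply/eqP; ring.
Qed.

(** For even N every point with singular reduction has both coordinates divisible by p^(N/2), so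
    [sum_num] is divisible by p^N, while [-4 d c] gives [prod_num] valuation exactly N. *)
Lemma has_index_nonsplit : has_index v E (if odd N then 1 else 2).
Proof.
have i0 : vge (0 : K) 1 by left.
have hc1 : vge c 1 by vg Qp.
have [No|Ne] := boolP (odd N).
  apply: (has_index1 (vge0 v 0) (veq_vge hd) i0 hc1) => x y hP hx.
  by have [k [eN _ _]] := nonsplit_singular_point hP hx; move: No; rewrite eN oddM.
have eN : N = (2 * N./2)%N by rewrite mul2n even_halfK.
apply: (has_index2 (vge0 v 0) (veq_vge hd) i0 hc1 (m := N%:Z)).
  exact: nonsplit_singular_point_exists eN.
move=> x1 y1 x2 y2 c1 c2 m1 m2.
have [k [e1 hx1 hy1]] := nonsplit_singular_point c1 m1.
have [k' [e2 hx2 hy2]] := nonsplit_singular_point c2 m2.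
have ek : k' = k by lia.
subst k'; rewrite /sum_num /prod_num; split.
  have hx : vge (x1 - x2) k by vg Qp.
  have hy : vge (y1 - y2) k by vg Qp.
  have hs : vge (d + x1 + x2) 0 by vg Qp.
  have h0' : vge (0 * (y1 - y2) * (x1 - x2)) N by rewrite !mul0r; left.
  by vg Qp.
have h2 := veq_two.
have -> : x1 ^+ 2 * x2 ^+ 2 - 2%:R * 0 * x1 * x2 - 4%:R * c * (x1 + x2)
  - (0 ^+ 2 * c + 4%:R * d * c - 0 ^+ 2)
  = - (2%:R ^+ 2 * d * c) + (x1 ^+ 2 * x2 ^+ 2 - 4%:R * c * (x1 + x2)) by ring.
have hx : vge (x1 + x2) 1 by vg Qp.
apply: (veqD Qp); last by vg Qp.
by apply: (veqN Qp); have := veqM Qp (veqM Qp (veqX Qp 2 h2) hd) hc; rewrite mul0r !add0r.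
Qed.

End NonsplitNode.
End SmallIndex.

(** * Reduction types *)

Section ReductionTypes.
Variables (K : fieldType) (v : K -> int) (p : nat).
Hypothesis Qp : is_Qp v p.
Notation vge := (Defs.vge v).
Notation veq := (veq v).
Implicit Types E W : wcoef K.

Lemma tamagawa_bad E W (N : int) (c : nat) : (exists u r s t, u != 0 /\ W = wchange u r s t E) ->
  wintegral v W -> veq (wdisc W) N -> 0 < N -> N < 12 \/ veq (wc4 W) 0 ->
  (has_index v W c -> tamagawa v E c) /\ bad_reduction v E.
Proof.
move=> hW iW hd N0 crit; have mW := minimalI Qp hW iW hd crit; split.
  by move=> hc; apply: (tamagawaI Qp mW hd.1 hc).
by exists W; rewrite hd.2.
Qed.

Lemma good_reduction E : wintegral v E -> veq (wdisc E) 0 -> ~ bad_reduction v E.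
Proof.
move=> iE hd [E' [[_ _ minE']]].
have := minE' 1 0 0 0 (oner_neq0 _); rewrite wchange_id => /(_ iE).
by rewrite hd.2; lia.
Qed.

Hypothesis p_pr : prime p.

Lemma split_node_tamagawa E W a c (N : nat) : (exists u r s t, u != 0 /\ W = wchange u r s t E) ->
  W = WC a 0 0 0 c -> veq a 0 -> veq c N -> (0 < N)%N -> tamagawa v E N /\ bad_reduction v E.
Proof.
move=> hW eW ha hc N0; have ha' := veq_vge ha.
have iW : wintegral v W by rewrite eW; split=> //=; try (by left); vg Qp.
have hd : veq (wdisc W) N.
  have -> : wdisc W = - (a ^+ 6 * c) - 432%:R * c ^+ 2.
    by rewrite eW /wdisc /wb2 /wb4 /wb6 /wb8 /=; ring.
  apply: (veqD Qp); last by vg Qp.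
  by apply: (veqN Qp); have := veqM Qp (veqX Qp 6 ha) hc; rewrite mul0r add0r.
have h4 : veq (wc4 W) 0.
  have -> : wc4 W = a ^+ 4 by rewrite eW /wc4 /wb2 /wb4 /=; ring.
  exact: (veq0X Qp).
have [t1 t2] := tamagawa_bad N hW iW hd N0 (or_intror h4).
by split=> //; apply: t1; rewrite eW; apply: (has_index_split Qp).
Qed.

(** Modulo p the tangents at the origin are [y = 0] and [y = - a1 x], both rational. With [a1] a
    unit, [a3], [a4] and [a2] are removed by Hensel, at p = 2 and 3 as well. *)
Lemma split_multiplicative_at_origin a1 a2 a3 a4 a6 (N : nat) :
  veq a1 0 -> vge a2 1 -> vge a3 1 -> vge a4 1 -> vge a6 1 ->
  veq (wdisc (WC a1 a2 a3 a4 a6)) N -> (0 < N)%N ->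
  tamagawa v (WC a1 a2 a3 a4 a6) N /\ bad_reduction v (WC a1 a2 a3 a4 a6).
Proof.
move=> h1 h2 h3 h4 h6 hd N0; have a10 := h1.1; have hV := veqV Qp h1.
(* Once [r] is eliminated by making the new [a3] vanish, the terms in [s] cancel from the new [a4].
   A quadratic in [t] remains, with linear coefficient [- a1] mod p. *)
have [t ht et] : exists2 t, vge t 1 &
    (a4 - 2%:R * a2 * a3 / a1 + 3%:R * a3 ^+ 2 / a1 ^+ 2)
    + (- a1 + (- (4%:R * a2) / a1 + 12%:R * a3 / a1 ^+ 2)) * t + (12%:R / a1 ^+ 2) * t ^+ 2 = 0.
  rewrite -!exprVn; apply: (quadratic_hensel Qp); [by vg Qp | | by vg Qp].
  by apply: (veqD Qp (veqN Qp h1)); vg Qp.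
pose r := - (a3 + 2%:R * t) / a1.
have hr : vge r 1 by apply: (vgeVu Qp h1); vg Qp.
have [s hs es] : exists2 s, vge s 1 & - (a2 + 3%:R * r) + a1 * s + 1 * s ^+ 2 = 0.
  by apply: (quadratic_hensel Qp) => //; [exact: (vge_one Qp) | vg Qp].
pose c := a6 + r * a4 + r ^+ 2 * a2 + r ^+ 3 - t * a3 - t ^+ 2 - r * t * a1.
have hc : vge c 1 by rewrite /c; vg Qp.
have eW : wchange 1 r s t (WC a1 a2 a3 a4 a6) = WC (a1 + 2%:R * s) 0 0 0 c.
  have e3 : a3 + r * a1 + 2%:R * t = 0 by rewrite /r; field.
  have e4 : a4 + 2%:R * r * a2 - t * a1 + 3%:R * r ^+ 2 = 0 by rewrite -et /r; field.
  rewrite /= !expr1n !divr1; congr WC => //.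
    by apply: oppr_inj; rewrite oppr0 -es; ring.
  rewrite -[RHS]e4 -[LHS]addr0 -[X in _ + X](mulr0 s) -e3; ring.
have ha : veq (a1 + 2%:R * s) 0 by apply: (veqD Qp h1); vg Qp.
apply: (split_node_tamagawa _ eW ha _ N0); first by exists 1, r, s, t; rewrite oner_neq0.
have := wdisc_change r s t (WC a1 a2 a3 a4 a6) (oner_neq0 _).
rewrite expr1n divr1 eW => e; rewrite -e in hd.
(* The discriminant of the normal form is [c] times this unit, so [c] inherits the valuation N. *)
have hu : veq (- ((a1 + 2%:R * s) ^+ 6 + 432%:R * c)) 0.
  by apply: (veqN Qp); apply: (veqD Qp (veq0X Qp 6 ha)); vg Qp.
have -> : c = wdisc (WC (a1 + 2%:R * s) 0 0 0 c) / - ((a1 + 2%:R * s) ^+ 6 + 432%:R * c).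
  apply: (mulIf hu.1); rewrite divfK ?hu.1 //.
  by rewrite /wdisc /wb2 /wb4 /wb6 /wb8 /=; ring.
by have := veqM Qp hd (veqV Qp hu); rewrite oppr0 addr0.
Qed.

(** * Reduction types for p >= 5 in terms of c4 and c6 *)

Section LargePrime.
Hypothesis p5 : (5 <= p)%N.

Lemma veq_2 : veq 2%:R 0.
Proof. by apply: (veq_nat0 Qp p_pr); rewrite gtnNdvd //; lia. Qed.

Lemma veq_3 : veq 3%:R 0.
Proof. by apply: (veq_nat0 Qp p_pr); rewrite gtnNdvd //; lia. Qed.

(** The classical [y^2 = x^3 - 27 c4 x - 54 c6], further scaled by [l]; the value [l = 5] will
    repair an equation that is not minimal at 5. *)
Lemma short_form E l : l != 0 -> exists u r s t, u != 0 /\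
  WC 0 0 0 (- 27%:R * wc4 E / l ^+ 4) (- 54%:R * wc6 E / l ^+ 6) = wchange u r s t E.
Proof.
move=> l0; have n2 := veq_2.1; have n3 := veq_3.1.
exists (l / 6%:R), (- wb2 E / 12%:R), (- wa1 E / 2%:R),
  (- (wa3 E - wb2 E / 12%:R * wa1 E) / 2%:R).
have n6 : (6%:R : K) != 0 by rewrite (natrM _ 2 3) mulf_neq0.
have n12 : (12%:R : K) != 0 by rewrite (natrM _ 2 6) mulf_neq0.
split; first by rewrite mulf_neq0 // invr_eq0.
case: E => a1 a2 a3 a4 a6; rewrite /wc4 /wc6 /wb2 /wb4 /wb6 /=; congr WC; field;
  by rewrite ?n2 ?n3 ?n6 ?n12 ?l0.
Qed.

Lemma wdisc_short (A B : K) : wdisc (WC 0 0 0 A B) = - (2%:R ^+ 4 * (4%:R * A ^+ 3 + 27%:R * B ^+ 2)).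
Proof. by rewrite /wdisc /wb2 /wb4 /wb6 /wb8 /=; ring. Qed.

Section Node.
Variables (E : wcoef K) (N : nat).
Hypotheses (iE : wintegral v E) (h4 : veq (wc4 E) 0) (hd : veq (wdisc E) N) (N0 : (0 < N)%N).

(** In short form [x^3 + A x + B], the origin is moved to an exact critical point of the cubic near
    its double root mod p, which kills the linear term. The coefficient [d] is then three times that
    abscissa. *)
Lemma node_form : exists d c,
  [/\ exists u r s t, u != 0 /\ WC 0 d 0 0 c = wchange u r s t E,
      veq d 0, veq c N & vge (d + 9%:R * wc6 E / wc4 E) 1].
Proof.
have [u [r [s [t [u0 eW]]]]] := short_form E (oner_neq0 _).
move: eW; rewrite !expr1n !divr1; set A := - 27%:R * _; set B := - 54%:R * _ => eW.
have h2 := veq_2; have h3 := veq_3.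
have hA : veq A 0.
  rewrite /A; have -> : - 27%:R = - 3%:R ^+ 3 :> K by ring.
  by have := veqM Qp (veqN Qp (veqX Qp 3 h3)) h4; rewrite mul0r add0r.
have eD : 1728%:R * wdisc E = wc4 E ^+ 3 - wc6 E ^+ 2.
  by case: (E) => a1 a2 a3 a4 a6; rewrite /wc4 /wc6 /wdisc /wb2 /wb4 /wb6 /wb8 /=; ring.
have hAB : veq (4%:R * A ^+ 3 + 27%:R * B ^+ 2) N.
  have -> : 4%:R * A ^+ 3 + 27%:R * B ^+ 2 = - (2%:R ^+ 8 * 3%:R ^+ 12 * wdisc E).
    have -> : 2%:R ^+ 8 * 3%:R ^+ 12 * wdisc E = 2%:R ^+ 2 * 3%:R ^+ 9 * (1728%:R * wdisc E) by ring.
    by rewrite eD /A /B; ring.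
  apply: (veqN Qp); have := veqM Qp (veqM Qp (veqX Qp 8 h2) (veqX Qp 12 h3)) hd.
  by rewrite !mul0r !add0r.
have hB : veq B 0.
  have hc6 := vge_c6 Qp iE.
  have i6 : vge B 0 by rewrite /B; vg Qp.
  have [//|hB] := vge_cases i6.
  have : vge (2%:R ^+ 2 * A ^+ 3) 1.
    have -> : 2%:R ^+ 2 * A ^+ 3 = (4%:R * A ^+ 3 + 27%:R * B ^+ 2) - 27%:R * B ^+ 2 by ring.
    by apply: (vgeB Qp); vg Qp.
  have h := veqM Qp (veqX Qp 2 h2) (veqX Qp 3 hA).
  by move/(veq_vge_le h).
have A0 := hA.1; have n2 := h2.1; have n3 := h3.1.
(* The double root mod p; [3 x0^2 + A] equals [(4 A^3 + 27 B^2) / (2 A)^2]. Three times [x0] is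
   [- 9 c6 / c4]. *)
pose x0 := - 3%:R * B / (2%:R * A).
have h2A : veq (2%:R * A) 0 by have := veqM Qp h2 hA; rewrite add0r.
have hx0 : veq x0 0.
  have := veqM Qp (veqM Qp (veqN Qp h3) hB) (veqV Qp h2A).
  by rewrite oppr0 !add0r.
have [z hz ez] : exists2 z, vge z 1 & (3%:R * x0 ^+ 2 + A) + (2%:R * 3%:R * x0) * z + 3%:R * z ^+ 2 = 0.
  apply: (quadratic_hensel Qp).
  - by vg Qp.
  - by have := veqM Qp (veqM Qp h2 h3) hx0; rewrite !add0r.
  have -> : 3%:R * x0 ^+ 2 + A = (4%:R * A ^+ 3 + 27%:R * B ^+ 2) / (2%:R * A) ^+ 2.
    by rewrite /x0; field; rewrite n2 A0.
  by apply: (vgeVu Qp (veq0X Qp 2 h2A)); vg Qp.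
pose x1 := x0 + z.
have hx1 : veq x1 0 by apply: (veqD Qp hx0); vg Qp.
have ex1 : 3%:R * x1 ^+ 2 + A = 0 by rewrite -ez /x1; ring.
pose c := B + A * x1 + x1 ^+ 3.
have hd3 : veq (3%:R * x1) 0 by have := veqM Qp h3 hx1; rewrite !add0r.
have hW : exists u r s t, u != 0 /\ WC 0 (3%:R * x1) 0 0 c = wchange u r s t E.
  exists (u * 1), (r + u ^+ 2 * x1), (s + u * 0), (t + u ^+ 3 * 0 + s * u ^+ 2 * x1).
  split; first by rewrite mulr1.
  rewrite -wchange_comp ?oner_neq0 // -eW /= !expr1n !divr1; congr WC; try ring.
    by rewrite -[LHS]ex1; ring.
  by rewrite /c; ring.
have ec : c = 2%:R * A / 3%:R * z.
  have -> : c = B + 2%:R * A / 3%:R * x1 + x1 / 3%:R * (3%:R * x1 ^+ 2 + A) by rewrite /c; field.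
  by rewrite ex1 mulr0 addr0 /x1 /x0; field; rewrite n2 n3 A0.
have hc1 : vge c 1.
  by rewrite ec mulrAC; apply: (vgeVu Qp h3); vg Qp.
exists (3%:R * x1), c; split=> //.
  have hu : veq (27%:R * c - 36%:R * A * x1) 0.
    rewrite addrC; apply: (veqD Qp); last by vg Qp.
    have -> : - (36%:R * A * x1) = - (2%:R * (2%:R * A) * x1 * 3%:R ^+ 2) by ring.
    by apply: (veqN Qp); have := veqM Qp (veqM Qp (veqM Qp h2 h2A) hx1) (veq0X Qp 2 h3); rewrite !add0r.
  have -> : c = (4%:R * A ^+ 3 + 27%:R * B ^+ 2) / (27%:R * c - 36%:R * A * x1).
    apply: (mulIf hu.1); rewrite divfK ?hu.1 //.
    have -> : A = - (3%:R * x1 ^+ 2) by apply/eqP; rewrite -subr_eq0 opprK addrC ex1.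
    have -> : B = c + 2%:R * x1 ^+ 3.
      rewrite /c; have -> : A = - (3%:R * x1 ^+ 2) by apply/eqP; rewrite -subr_eq0 opprK addrC ex1.
      by ring.
    by ring.
  by have := veqM Qp hAB (veqV Qp hu); rewrite oppr0 addr0.
have -> : 3%:R * x1 + 9%:R * wc6 E / wc4 E = 3%:R * z.
  have c40 := h4.1.
  have n27 : - 27%:R != 0 :> K by rewrite (_ : - 27%:R = - 3%:R ^+ 3) ?oppr_eq0 ?expf_neq0 //; ring.
  by rewrite /x1 /x0 /A /B; field; rewrite c40 n27 n2.
by vg Qp.
Qed.

Lemma node_disc_c4 d c : veq d 0 -> veq c N ->
  [/\ wintegral v (WC 0 d 0 0 c), veq (wdisc (WC 0 d 0 0 c)) N & veq (wc4 (WC 0 d 0 0 c)) 0].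
Proof.
move=> hd0 hc; have h2 := veq_2; split.
- by split=> /=; first [by left | vg Qp].
- have -> : wdisc (WC 0 d 0 0 c) = - (2%:R ^+ 6 * d ^+ 3 * c) - 432%:R * c ^+ 2.
    by rewrite /wdisc /wb2 /wb4 /wb6 /wb8 /=; ring.
  apply: (veqD Qp); last by vg Qp.
  apply: (veqN Qp); have := veqM Qp (veqM Qp (veqX Qp 6 h2) (veqX Qp 3 hd0)) hc.
  by rewrite !mul0r !add0r.
have -> : wc4 (WC 0 d 0 0 c) = 2%:R ^+ 4 * d ^+ 2 by rewrite /wc4 /wb2 /wb4 /=; ring.
by have := veqM Qp (veqX Qp 4 h2) (veqX Qp 2 hd0); rewrite !mul0r add0r.
Qed.

Lemma multiplicative_bad : bad_reduction v E.
Proof.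
have [d [c [hW hd0 hc _]]] := node_form; have [iW dW cW] := node_disc_c4 hd0 hc.
by have [_ ?] := tamagawa_bad 1 hW iW dW N0 (or_intror cW).
Qed.

(** Since [d] is [- 9 c6 / c4] mod p, the element [3 w / c4] is a square root of [d] mod p. Hensel
    makes it an exact root [e], and [s = e] turns [y^2 - d x^2] into [y (y + 2 e x)]. *)
Lemma split_multiplicative : (exists2 w, vge w 0 & vge (w ^+ 2 + wc4 E * wc6 E) 1) ->
  tamagawa v E N.
Proof.
move=> [w hw hw2]; have [d [c [hW hd0 hc hdd]]] := node_form.
have c40 := h4.1; have h2 := veq_2; have h3 := veq_3.
pose e0 := 3%:R * w / wc4 E.
have he0 : vge e0 0 by apply: (vgeVu Qp h4); vg Qp.
have hed : vge (e0 ^+ 2 - d) 1.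
  have -> : e0 ^+ 2 - d = 9%:R * (w ^+ 2 + wc4 E * wc6 E) / wc4 E ^+ 2 - (d + 9%:R * wc6 E / wc4 E).
    by rewrite /e0; field.
  apply: (vgeB Qp) => //; apply: (vgeVu Qp (veq0X Qp 2 h4)); vg Qp.
have he0u : veq e0 0.
  have [//|he1] := vge_cases he0; have : vge d 1.
    have -> : d = e0 ^+ 2 - (e0 ^+ 2 - d) by ring.
    by apply: (vgeB Qp) => //; vg Qp.
  by move/(veq_vge_le hd0).
have [z hz ez] : exists2 z, vge z 1 & (e0 ^+ 2 - d) + 2%:R * e0 * z + 1 * z ^+ 2 = 0.
  apply: (quadratic_hensel Qp) => //; first exact: (vge_one Qp).
  by have := veqM Qp h2 he0u; rewrite add0r.
pose e := e0 + z.
have he : veq (2%:R * e) 0.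
  by have := veqM Qp h2 (veqD Qp he0u hz); rewrite add0r.
have [u [r [s [t [u0 eW]]]]] := hW.
have eW2 : wchange 1 0 e 0 (WC 0 d 0 0 c) = WC (2%:R * e) 0 0 0 c.
  rewrite /= !expr1n !divr1; congr WC; try ring.
  by apply: oppr_inj; rewrite oppr0 -[RHS]ez /e; ring.
have hW2 : exists u r s t, u != 0 /\ WC (2%:R * e) 0 0 0 c = wchange u r s t E.
  exists (u * 1), (r + u ^+ 2 * 0), (s + u * e), (t + u ^+ 3 * 0 + s * u ^+ 2 * 0).
  split; first by rewrite mulr1.
  by rewrite -wchange_comp ?oner_neq0 // -eW eW2.
by have [] := split_node_tamagawa hW2 erefl he hc N0.
Qed.

Lemma nonsplit_multiplicative : (forall w, vge w 0 -> ~ vge (w ^+ 2 + wc4 E * wc6 E) 1) ->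
  tamagawa v E (if odd N then 1 else 2).
Proof.
move=> hns; have [d [c [hW hd0 hc hdd]]] := node_form; have [iW dW cW] := node_disc_c4 hd0 hc.
have [tam _] := tamagawa_bad (if odd N then 1 else 2) hW iW dW N0 (or_intror cW).
have c40 := h4.1; have h3 := veq_3; have n3 := h3.1.
apply: tam; apply: (has_index_nonsplit Qp) => //.
  by have [e|//] := even_prime p_pr; move: p5; rewrite e.
move=> z hz hzd; apply: (hns (z * wc4 E / 3%:R)); first by apply: (vgeVu Qp h3); vg Qp.
have -> : (z * wc4 E / 3%:R) ^+ 2 + wc4 E * wc6 E =
   (z ^+ 2 - d + (d + 9%:R * wc6 E / wc4 E)) * wc4 E ^+ 2 / 3%:R ^+ 2.
  have n9 : (9%:R : K) != 0 by rewrite (natrM _ 3 3) mulf_neq0.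
  by field; rewrite n9 c40 n3.
apply: (vgeVu Qp (veq0X Qp 2 h3)).
have h : vge (z ^+ 2 - d + (d + 9%:R * wc6 E / wc4 E)) 1 by apply: (vgeD Qp).
by vg Qp.
Qed.

End Node.

Section Additive.
Variables (E : wcoef K) (l : K).
Hypothesis l0 : l != 0.
Let A := - 27%:R * wc4 E / l ^+ 4.
Let B := - 54%:R * wc6 E / l ^+ 6.

Lemma wintegral_short : vge A 1 -> vge B 1 -> wintegral v (WC 0 0 0 A B).
Proof. by move=> hA hB; split=> /=; first [by left | vg Qp]. Qed.

Lemma veq_disc_short_B (m : int) : vge (A ^+ 3) (2 * m + 1) -> veq B m ->
  veq (wdisc (WC 0 0 0 A B)) (2 * m).
Proof.
move=> hA hB; have h2 := veq_2; have h3 := veq_3; rewrite wdisc_short; apply: (veqN Qp).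
have -> : 2%:R ^+ 4 * (4%:R * A ^+ 3 + 27%:R * B ^+ 2) =
   2%:R ^+ 4 * 3%:R ^+ 3 * B ^+ 2 + 2%:R ^+ 4 * 4%:R * A ^+ 3 by ring.
apply: (veqD Qp); last by vg Qp.
have -> : 2 * m = 0 * 4%:Z + 0 * 3%:Z + m * 2%:Z by lia.
exact: (veqM Qp (veqM Qp (veqX Qp 4 h2) (veqX Qp 3 h3)) (veqX Qp 2 hB)).
Qed.

Lemma short_curveE x y : on_curve (WC 0 0 0 A B) (Some (x, y)) <-> y ^+ 2 = x ^+ 3 + A * x + B.
Proof. by rewrite /= !mul0r !addr0; split=> /eqP. Qed.

(** A point with p dividing [x] also has p dividing [y], so [B = y^2 - x^3 - A x] would be divisible
    by p^2. *)
Lemma additive_II : vge A 1 -> veq B 1 -> tamagawa v E 1 /\ bad_reduction v E.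
Proof.
move=> hA hB; have hd : veq (wdisc (WC 0 0 0 A B)) 2.
  by apply: (veq_disc_short_B (m := 1)) => //; vg Qp.
have [tam bad] := tamagawa_bad 1 (short_form E l0) (wintegral_short hA (veq_vge hB)) hd isT (or_introl isT).
split=> //; apply: tam; apply: (has_index1 Qp (vge0 v 0) (vge0 v 0) hA (veq_vge hB)).
move=> x y hP hx.
have hy := on_curve_singular_y Qp (vge0 v 0) (vge0 v 0) hA (veq_vge hB) hP hx.
have : vge B 2.
  move/short_curveE: hP => e; have -> : B = y ^+ 2 - (x ^+ 3 + A * x) by rewrite e; ring.
  by vg Qp.
by move/(veq_vge_le hB).
Qed.

(** On a point with p dividing [x], [y^2] would have odd valuation: 3 from [x^3] when [v x = 1], and
    5 from [B] otherwise. *)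
Lemma additive_IIstar : vge A 4 -> veq B 5 -> tamagawa v E 1 /\ bad_reduction v E.
Proof.
move=> hA hB; have hd : veq (wdisc (WC 0 0 0 A B)) 10.
  by apply: (veq_disc_short_B (m := 5)) => //; vg Qp.
have hA1 : vge A 1 by vg Qp.
have hB1 : vge B 1 by vg Qp.
have [tam bad] := tamagawa_bad 1 (short_form E l0) (wintegral_short hA1 hB1) hd isT (or_introl isT).
split=> //; apply: tam; apply: (has_index1 Qp (vge0 v 0) (vge0 v 0) hA1 hB1).
move=> x y /short_curveE e hx.
have odd_sq (m : int) : veq (y ^+ 2) (2 * m + 1) -> False.
  move=> h; have y0 : y != 0 by have := h.1; rewrite expf_eq0.
  by have := veq_inj h (veqX Qp 2 (veq_val v y0)); lia.
have [hx1|hx2] := vge_cases hx.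
  apply: (odd_sq 1); rewrite e -addrA; apply: (veqD Qp (veqX Qp 3 hx1)); vg Qp.
by apply: (odd_sq 2); rewrite e addrC; apply: (veqD Qp hB); vg Qp.
Qed.

(** The singular point lifts to a 2-torsion point [(x, 0)]: although [A] is not a unit,
    [x = - (x^3 + B) / A] is still a contraction on multiples of p. The term [A^2] gives [prod_num]
    valuation exactly 2. *)
Lemma additive_III : veq A 1 -> vge B 2 -> tamagawa v E 2 /\ bad_reduction v E.
Proof.
move=> hA hB; have h2 := veq_2; have A0 := hA.1; have hB1 : vge B 1 by vg Qp.
have hd : veq (wdisc (WC 0 0 0 A B)) 3.
  rewrite wdisc_short; apply: (veqN Qp).
  have -> : 2%:R ^+ 4 * (4%:R * A ^+ 3 + 27%:R * B ^+ 2) =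
     2%:R ^+ 6 * A ^+ 3 + 2%:R ^+ 4 * 27%:R * B ^+ 2 by ring.
  apply: (veqD Qp); last by vg Qp.
  by have := veqM Qp (veqX Qp 6 h2) (veqX Qp 3 hA).
have [tam bad] := tamagawa_bad 2 (short_form E l0) (wintegral_short (veq_vge hA) hB1) hd isT (or_introl isT).
split=> //; apply: tam.
apply: (has_index2 Qp (vge0 v 0) (vge0 v 0) (veq_vge hA) hB1 (m := 2)).
  pose g x := - (x ^+ 3 + B) / A.
  have [z hz|z w m hz hw hzw|x hx ex] := contraction_fixpoint Qp (g := g).
  - by apply: (vge_divr Qp hA (m := 2)) => //; vg Qp.
  - have -> : g z - g w = - ((z ^+ 2 + z * w + w ^+ 2) * (z - w)) / A by rewrite /g; field.
    apply: (vge_divr Qp hA (m := m + 2)); last by lia.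
    have h : vge (z ^+ 2 + z * w + w ^+ 2) 2 by vg Qp.
    by vg Qp.
  exists x, 0; split=> //; apply/short_curveE.
  have : A * g x = A * x by rewrite ex.
  by rewrite /g mulrC divfK // => <-; ring.
move=> x1 y1 x2 y2 c1 c2 hx1 hx2.
have hy1 := on_curve_singular_y Qp (vge0 v 0) (vge0 v 0) (veq_vge hA) hB1 c1 hx1.
have hy2 := on_curve_singular_y Qp (vge0 v 0) (vge0 v 0) (veq_vge hA) hB1 c2 hx2.
have hx : vge (x1 - x2) 1 by vg Qp.
have hx' : vge (x1 + x2) 1 by vg Qp.
have hy : vge (y1 - y2) 1 by vg Qp.
split; rewrite /sum_num /prod_num.
  by rewrite !mul0r addr0 add0r; vg Qp.
have -> : x1 ^+ 2 * x2 ^+ 2 - 2%:R * A * x1 * x2 - 4%:R * B * (x1 + x2)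
   - (0 ^+ 2 * B + 4%:R * 0 * B - A ^+ 2)
  = A ^+ 2 + (x1 ^+ 2 * x2 ^+ 2 - 2%:R * A * x1 * x2 - 4%:R * B * (x1 + x2)) by ring.
by apply: (veqD Qp (veqX Qp 2 hA)); vg Qp.
Qed.

End Additive.
End LargePrime.
End ReductionTypes.

(** * The curves with a point of order 5 *)

Lemma euclidz (p : nat) (x y : int) : prime p ->
  (p%:Z %| x * y)%Z = (p%:Z %| x)%Z || (p%:Z %| y)%Z.
Proof. by move=> p_pr; rewrite !dvdzE abszM Euclid_dvdM. Qed.

Definition C5_quad (a b : int) : int := a ^+ 2 + 11%:R * a * b - b ^+ 2.

(** * Primes dividing a^2 + 11ab - b^2 *)

Section Coprime.
Variables a b : int.
Hypothesis cop : coprimez a b.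

Lemma coprimez_prime (p : nat) : prime p -> (p%:Z %| a)%Z -> ~~ (p%:Z %| b)%Z.
Proof.
move=> p_pr pa; apply/negP => pb.
have : (p%:Z %| gcdz a b)%Z by rewrite dvdz_gcd pa.
by rewrite (eqP cop) dvdzE /= dvdn1 => /eqP p1; rewrite p1 in p_pr.
Qed.

Lemma C5_quad_mod_prime (p : nat) : prime p -> (p%:Z %| a * b)%Z -> ~~ (p%:Z %| C5_quad a b)%Z.
Proof.
move=> p_pr pab; apply/negP => pq.
have pa2 : (p%:Z %| a * a)%Z || (p%:Z %| b * b)%Z.
  by move: pab; rewrite !euclidz // => /orP[|] ->; rewrite ?orbT.
have hd : (p%:Z %| a ^+ 2 - b ^+ 2)%Z.
  have -> : a ^+ 2 - b ^+ 2 = C5_quad a b - 11%:R * (a * b) by rewrite /C5_quad; ring.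
  by rewrite rpredB // dvdz_mull.
have pa : (p%:Z %| a)%Z.
  case/orP: pa2; first by rewrite euclidz // orbb.
  move=> pb; have : (p%:Z %| a * a)%Z.
    have -> : a * a = (a ^+ 2 - b ^+ 2) + b * b by ring.
    by rewrite rpredD.
  by rewrite euclidz // orbb.
have := coprimez_prime p_pr pa; rewrite -[X in ~~ X]orbb -euclidz //.
have -> : b * b = a * a - (a ^+ 2 - b ^+ 2) by ring.
by rewrite rpredB // dvdz_mull.
Qed.

Lemma C5_quad_mod2 : ~~ (2 %| C5_quad a b)%Z.
Proof.
have [/C5_quad_mod_prime|] := boolP (2%:Z %| a * b)%Z; first by apply.
rewrite euclidz // => hab; apply/negP => hq.
have : (2%:Z %| b * b)%Z.
  have -> : b * b = a * (a + 11%:R * b) - C5_quad a b by rewrite /C5_quad; ring.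
  by rewrite rpredB // dvdz_mull //; lia.
by rewrite euclidz // orbb; lia.
Qed.

Lemma C5_quad_neq0 : C5_quad a b != 0.
Proof. by apply: contraNneq C5_quad_mod2 => ->. Qed.

Lemma C5_quad_mod3 : ~~ (3 %| C5_quad a b)%Z.
Proof.
have [/C5_quad_mod_prime|hab] := boolP (3%:Z %| a * b)%Z; first by apply.
apply/negP => hq.
have sq (x : int) : ~~ (3 %| x)%Z -> (3 %| x ^+ 2 - 1)%Z.
  move=> hx; have -> : x ^+ 2 - 1 = (x - 1) * (x + 1) by ring.
  by rewrite (euclidz _ _ (isT : prime 3)); lia.
have : (3%:Z %| 11%:R * (a * b))%Z.
  have -> : 11%:R * (a * b) = C5_quad a b - (a ^+ 2 - 1) + (b ^+ 2 - 1) by rewrite /C5_quad; ring.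
  by move: hab; rewrite euclidz // negb_or => /andP[/sq ? /sq ?]; rewrite rpredD // rpredB.
by rewrite euclidz // (negPf hab).
Qed.

Lemma C5_quad_mod5 : (5 %| C5_quad a b)%Z -> (5 %| a + 18%:R * b)%Z.
Proof.
move=> hq; have : (5%:Z %| (a + 18%:R * b) * (a + 18%:R * b))%Z.
  have -> : (a + 18%:R * b) * (a + 18%:R * b) = C5_quad a b + 5%:Z * (5%:R * b * (a + 13%:R * b)).
    by rewrite /C5_quad; ring.
  by rewrite rpredD // dvdz_mulr.
by rewrite euclidz // orbb.
Qed.

End Coprime.

(** * Invariants of the two curves, arranged by powers of [Q] *)

Section Invariants.
Variables (K : fieldType) (a b : int).
Let A : K := a%:~R.
Let B : K := b%:~R.
Let Q : K := (C5_quad a b)%:~R.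

Lemma C5_quad_K : Q = A ^+ 2 + 11%:R * A * B - B ^+ 2.
Proof. by rewrite /Q /C5_quad /A /B !expr2 !(rmorphB, rmorphD, rmorphM) /=; ring. Qed.

Lemma EC5_K : intK K (EC5 a b) = WC (A - B) (- (A * B)) (- (A ^+ 2 * B)) 0 0.
Proof.
by rewrite /intK /wmap /EC5 /= !expr2; congr WC; rewrite ?(rmorphN, rmorphB, rmorphM).
Qed.

Lemma EC5t_K : intK K (EC5t a b) = WC (A - B) (- (A * B)) (- (A ^+ 2 * B))
  (5%:R * A * B * (A ^+ 2 - 2%:R * A * B - B ^+ 2))
  (A * B * (A ^+ 4 - 15%:R * A ^+ 3 * B + 5%:R * A ^+ 2 * B ^+ 2 - 10%:R * A * B ^+ 3 - B ^+ 4)).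
Proof.
rewrite /intK /wmap /EC5t /= !(exprS, expr0, mulr1); congr WC;
  by rewrite ?(rmorphN, rmorphB, rmorphD, rmorphM).
Qed.

Lemma c4_EC5 : wc4 (intK K (EC5 a b)) = 5%:R * (A * B) ^+ 2 + Q * (Q - 10%:R * A * B).
Proof. by rewrite EC5_K C5_quad_K /wc4 /wb2 /wb4 /=; ring. Qed.

Lemma c6_EC5 : wc6 (intK K (EC5 a b)) = (A ^+ 2 + B ^+ 2) * ((A * B) ^+ 2 - Q * (Q - 4%:R * A * B)).
Proof. by rewrite EC5_K C5_quad_K /wc6 /wb2 /wb4 /wb6 /=; ring. Qed.

Lemma disc_EC5 : wdisc (intK K (EC5 a b)) = - ((A * B) ^+ 5 * Q).
Proof. by rewrite EC5_K C5_quad_K /wdisc /wb2 /wb4 /wb6 /wb8 /=; ring. Qed.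

Lemma c4_EC5t : wc4 (intK K (EC5t a b)) =
  5%:R ^+ 5 * (A * B) ^+ 2 + Q * (Q - 2%:R * 5%:R ^+ 3 * A * B).
Proof. by rewrite EC5t_K C5_quad_K /wc4 /wb2 /wb4 /=; ring. Qed.

Lemma c6_EC5t : wc6 (intK K (EC5t a b)) =
  (A ^+ 2 + B ^+ 2) * (5%:R ^+ 6 * (A * B) ^+ 2 - Q * (Q + 4%:R * 5%:R ^+ 3 * A * B)).
Proof. by rewrite EC5t_K C5_quad_K /wc6 /wb2 /wb4 /wb6 /=; ring. Qed.

Lemma disc_EC5t : wdisc (intK K (EC5t a b)) = - (A * B * Q ^+ 5).
Proof. by rewrite EC5t_K C5_quad_K /wdisc /wb2 /wb4 /wb6 /wb8 /=; ring. Qed.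

End Invariants.

(** * Reduction of the two curves at a given prime *)

Section LocalData.
Variables (K : fieldType) (v : K -> int) (p : nat).
Hypothesis Qp : is_Qp v p.
Hypothesis p_pr : prime p.
Notation vge := (Defs.vge v).
Notation veq := (veq v).

Lemma legendre1 (x : int) (U T : K) : vge U 0 -> vge (T + x%:~R * U ^+ 2) 1 ->
  legendre x p = 1 -> exists2 w, vge w 0 & vge (w ^+ 2 + T) 1.
Proof.
move=> hU hT; rewrite /legendre; case: ifP => // _; case: ifP => // /existsP [y hy] _.
have h := elimT (vge_intP Qp p_pr _) hy.
exists ((y : nat)%:R * U); first by vg Qp.
have -> : ((y : nat)%:R * U) ^+ 2 + T
    = ((y : nat)%:Z ^+ 2 - x)%:~R * U ^+ 2 + (T + x%:~R * U ^+ 2).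
  by rewrite expr2 rmorphB expr2 rmorphM /=; ring.
by vg Qp.
Qed.

(** Here [-T] is [x U^2] mod p, so a root of [-T] divided by the unit [U] would be a root of [x];
    [residue] moves it into the range of [legendre]. *)
Lemma legendreN1 (x : int) (U T : K) : veq U 0 -> vge (T + x%:~R * U ^+ 2) 1 ->
  legendre x p = -1 -> forall w, vge w 0 -> ~ vge (w ^+ 2 + T) 1.
Proof.
move=> hU hT; rewrite /legendre; case: ifP => // _; case: ifP => // /negbT/negP nsq _ w hw hwT.
apply: nsq; have U0 := hU.1.
have hz : vge (w / U) 0 by apply: (vgeVu Qp hU).
have [k kp hk] := residue Qp p_pr hz.
apply/existsP; exists (Ordinal kp); apply/(vge_intP Qp p_pr) => /=.
have -> : (k%:Z ^+ 2 - x)%:~R = (w ^+ 2 + T - (T + x%:~R * U ^+ 2)) / U ^+ 2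
    - (w / U - k%:R) * (w / U + k%:R).
  by rewrite expr2 rmorphB rmorphM /=; field.
have h : vge (w ^+ 2 + T - (T + x%:~R * U ^+ 2)) 1 by apply: (vgeB Qp).
have h' : vge (w / U + k%:R) 0 by apply: (vgeD Qp) => //; exact: (vge_nat Qp).
apply: (vgeB Qp); first by apply: (vgeVu Qp (veq0X Qp 2 hU)).
by vg Qp.
Qed.

Variables a b : int.
Hypothesis cop : coprimez a b.
Let E := intK K (EC5 a b).
Let Et := intK K (EC5t a b).
Let A : K := a%:~R.
Let B : K := b%:~R.
Let Q : K := (C5_quad a b)%:~R.

Lemma wintegral_intK (F : wcoef int) : wintegral v (intK K F).
Proof. by case: F => *; split=> /=; apply: (vge_int Qp). Qed.

Lemma veq_AB : a * b != 0 -> veq (A * B) (logn p `|a * b|).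
Proof. by move=> ab0; rewrite /A /B -rmorphM; apply: (veq_int Qp p_pr). Qed.

Lemma veq_Q : veq Q (logn p `|C5_quad a b|).
Proof. by apply: (veq_int Qp p_pr); apply: (C5_quad_neq0 cop). Qed.

Lemma dvdz_logn (x : int) : x != 0 -> (p%:Z %| x)%Z = (0 < logn p `|x|)%N.
Proof. by move=> x0; rewrite dvdzE /= logn_gt0 mem_primes p_pr absz_gt0 x0. Qed.

Lemma good_cases : ~~ (p%:Z %| a * b)%Z -> ~~ (p%:Z %| C5_quad a b)%Z ->
  ~ bad_reduction v E /\ ~ bad_reduction v Et.
Proof.
move=> hab hq; have hAB : veq (A * B) 0 by rewrite /A /B -rmorphM; apply: (veq_int0 Qp p_pr).
have hQ : veq Q 0 by apply: (veq_int0 Qp p_pr).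
split; apply: (good_reduction (wintegral_intK _)).
  rewrite disc_EC5 -/A -/B -/Q; apply: (veqN Qp).
  by have := veqM Qp (veq0X Qp 5 hAB) hQ; rewrite addr0.
rewrite disc_EC5t -/A -/B -/Q; apply: (veqN Qp).
by have := veqM Qp hAB (veq0X Qp 5 hQ); rewrite addr0.
Qed.

Lemma split_case : a * b != 0 -> (p%:Z %| a * b)%Z -> let n := logn p `|a * b| in
  (tamagawa v E (5 * n) /\ bad_reduction v E) /\ (tamagawa v Et n /\ bad_reduction v Et).
Proof.
move=> ab0 pab n; have n0 : (0 < n)%N by rewrite -dvdz_logn.
have hAB := veq_AB ab0; rewrite -/n in hAB.
have hQ : veq Q 0 by apply: (veq_int0 Qp p_pr); apply: (C5_quad_mod_prime cop).
have hA := vge_int Qp a; have hB := vge_int Qp b; rewrite -/A in hA; rewrite -/B in hB.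
have h1 : veq (A - B) 0.
  rewrite /A /B -rmorphB; apply: (veq_int0 Qp p_pr); apply/negP => pd.
  have [pa pb] : (p%:Z %| a)%Z /\ (p%:Z %| b)%Z.
    move: pab; rewrite euclidz // => /orP[h|h]; split=> //.
      by have -> : b = a - (a - b) by [ring]; rewrite rpredB.
    by have -> : a = (a - b) + b by [ring]; rewrite rpredD.
  by move: (coprimez_prime cop p_pr pa); rewrite pb.
have h2 : vge (- (A * B)) 1 by vg Qp.
have h3 : vge (- (A ^+ 2 * B)) 1.
  by have -> : A ^+ 2 * B = A * (A * B) by [ring]; vg Qp.
split.
  have := disc_EC5 K a b; rewrite /E EC5_K -/A -/B -/Q => dE.
  apply: (split_multiplicative_at_origin Qp p_pr h1 h2 h3 (vge0 v 1) (vge0 v 1)); last by lia.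
  rewrite dE; apply: (veqN Qp); have := veqM Qp (veqX Qp 5 hAB) hQ.
  by have -> : n%:Z * 5%:Z + 0 = (5 * n)%N by lia.
have := disc_EC5t K a b; rewrite /Et EC5t_K -/A -/B -/Q => dE.
apply: (split_multiplicative_at_origin Qp p_pr h1 h2 h3 _ _ _ n0).
- have h : vge (A ^+ 2 - 2%:R * A * B - B ^+ 2) 0 by vg Qp.
  by have -> : 5%:R * A * B = 5%:R * (A * B) by [ring]; vg Qp.
- have h : vge (A ^+ 4 - 15%:R * A ^+ 3 * B + 5%:R * A ^+ 2 * B ^+ 2 - 10%:R * A * B ^+ 3 - B ^+ 4) 0.
    by vg Qp.
  by vg Qp.
rewrite dE; apply: (veqN Qp).
by have := veqM Qp hAB (veq0X Qp 5 hQ); rewrite addr0.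
Qed.

Lemma node_case : (7 <= p)%N -> (p%:Z %| C5_quad a b)%Z ->
  let n := logn p `|C5_quad a b| in
  let l := legendre (- 5%:R * (a ^+ 2 + b ^+ 2)) p in
  [/\ bad_reduction v E /\ bad_reduction v Et,
      l = 1 -> tamagawa v E n /\ tamagawa v Et (5 * n) &
      l = -1 -> tamagawa v E (if odd n then 1 else 2) /\ tamagawa v Et (if odd n then 1 else 2)].
Proof.
move=> p7 pq n l; have p5 : (5 <= p)%N by lia.
have n0 : (0 < n)%N by rewrite -dvdz_logn // (C5_quad_neq0 cop).
have n50 : (0 < 5 * n)%N by lia.
have hQ := veq_Q; rewrite -/n in hQ.
have hAB : veq (A * B) 0.
  rewrite /A /B -rmorphM; apply: (veq_int0 Qp p_pr); apply/negP => /(C5_quad_mod_prime cop p_pr).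
  by rewrite pq.
have hA := vge_int Qp a; have hB := vge_int Qp b; rewrite -/A in hA; rewrite -/B in hB.
have h5 : veq (5%:R : K) 0 by apply: (veq_nat0 Qp p_pr); rewrite gtnNdvd //; lia.
have h5X k : veq (5%:R ^+ k : K) 0 by apply: (veq0X Qp).
have iE := wintegral_intK (EC5 a b); have iEt := wintegral_intK (EC5t a b).
set m := Q - 10%:R * A * B; set m' := Q - 4%:R * A * B.
set t := Q - 2%:R * 5%:R ^+ 3 * A * B; set t' := Q + 4%:R * 5%:R ^+ 3 * A * B.
have [hm hm' ht ht'] : [/\ vge m 0, vge m' 0, vge t 0 & vge t' 0].
  by rewrite /m /m' /t /t'; split; vg Qp.
have c4E : veq (wc4 E) 0.
  rewrite c4_EC5 -/A -/B -/Q -/m; apply: (veqD Qp); last by vg Qp.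
  by have := veqM Qp h5 (veq0X Qp 2 hAB); rewrite addr0.
have c4Et : veq (wc4 Et) 0.
  rewrite c4_EC5t -/A -/B -/Q -/t; apply: (veqD Qp); last by vg Qp.
  by have := veqM Qp (h5X 5) (veq0X Qp 2 hAB); rewrite addr0.
have dE : veq (wdisc E) n.
  rewrite disc_EC5 -/A -/B -/Q; apply: (veqN Qp).
  by have := veqM Qp (veq0X Qp 5 hAB) hQ; rewrite add0r.
have dEt : veq (wdisc Et) (5 * n)%N.
  rewrite disc_EC5t -/A -/B -/Q; apply: (veqN Qp).
  have := veqM Qp hAB (veqX Qp 5 hQ).
  by have -> : 0 + n%:Z * 5%:Z = (5 * n)%N by lia.
set x := - 5%:R * (a ^+ 2 + b ^+ 2) in l *.
have ex : x%:~R = - 5%:R * (A ^+ 2 + B ^+ 2) :> K.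
  by rewrite /x /A /B !expr2 mulNr rmorphN !(rmorphM, rmorphD) /= mulNr.
(* Modulo [Q], the product [- c4 c6] is [-5 (a^2 + b^2)] times the square of [U], respectively of
   [Ut]; for the second curve [5^5 * 5^6 = 5 * (5^5)^2]. *)
pose U := (A * B) ^+ 2; pose Ut := 5%:R ^+ 5 * (A * B) ^+ 2.
have hU : veq U 0 by apply: (veq0X Qp).
have hUt : veq Ut 0 by have := veqM Qp (h5X 5) hU; rewrite addr0.
have hs : vge (A ^+ 2 + B ^+ 2) 0 by vg Qp.
have TE : vge (wc4 E * wc6 E + x%:~R * U ^+ 2) 1.
  rewrite ex c4_EC5 c6_EC5 -/A -/B -/Q -/m -/m'.
  have -> : (5%:R * (A * B) ^+ 2 + Q * m) * ((A ^+ 2 + B ^+ 2) * ((A * B) ^+ 2 - Q * m'))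
     + - 5%:R * (A ^+ 2 + B ^+ 2) * U ^+ 2
     = Q * (A ^+ 2 + B ^+ 2) * (m * (A * B) ^+ 2 - 5%:R * (A * B) ^+ 2 * m' - Q * m * m').
    by rewrite /U; ring.
  have h : vge (m * (A * B) ^+ 2 - 5%:R * (A * B) ^+ 2 * m' - Q * m * m') 0 by vg Qp.
  by vg Qp.
have TEt : vge (wc4 Et * wc6 Et + x%:~R * Ut ^+ 2) 1.
  rewrite ex c4_EC5t c6_EC5t -/A -/B -/Q -/t -/t'.
  have -> : (5%:R ^+ 5 * (A * B) ^+ 2 + Q * t) *
        ((A ^+ 2 + B ^+ 2) * (5%:R ^+ 6 * (A * B) ^+ 2 - Q * t'))
     + - 5%:R * (A ^+ 2 + B ^+ 2) * Ut ^+ 2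
     = Q * (A ^+ 2 + B ^+ 2) *
       (5%:R ^+ 6 * t * (A * B) ^+ 2 - 5%:R ^+ 5 * (A * B) ^+ 2 * t' - Q * t * t').
    by rewrite /Ut; ring.
  have h : vge (5%:R ^+ 6 * t * (A * B) ^+ 2 - 5%:R ^+ 5 * (A * B) ^+ 2 * t' - Q * t * t') 0.
    by vg Qp.
  by vg Qp.
split.
- split; first exact: (multiplicative_bad Qp p_pr p5 iE c4E dE n0).
  exact: (multiplicative_bad Qp p_pr p5 iEt c4Et dEt n50).
- move=> l1; split.
    by apply: (split_multiplicative Qp p_pr p5 iE c4E dE n0); apply: (legendre1 (veq_vge hU) TE).
  by apply: (split_multiplicative Qp p_pr p5 iEt c4Et dEt n50); apply: (legendre1 (veq_vge hUt) TEt).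
move=> l1; split.
  by apply: (nonsplit_multiplicative Qp p_pr p5 iE c4E dE n0); apply: (legendreN1 hU TE).
have -> : odd n = odd (5 * n) by rewrite oddM.
by apply: (nonsplit_multiplicative Qp p_pr p5 iEt c4Et dEt n50); apply: (legendreN1 hUt TEt).
Qed.

(** When [S = a + 18 b] has valuation 1, the types are II for the first curve and II* for the
    second; when the valuation is at least 2, both are of type III. *)
Lemma five_case : p = 5%N -> (5 %| a + 18%:R * b)%Z ->
  let c := if (25 %| a + 18%:R * b)%Z then 2%N else 1%N in
  (tamagawa v E c /\ bad_reduction v E) /\ (tamagawa v Et c /\ bad_reduction v Et).
Proof.
move=> p5 hS c; have p5' : (5 <= p)%N by rewrite p5.
have hS' : (p%:Z %| a + 18%:R * b)%Z by rewrite p5.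
have hpi : veq (5%:R : K) 1 by rewrite -p5; apply: (veq_pi Qp).
have hb : ~~ (p%:Z %| b)%Z.
  apply/negP => pb; have pa : (p%:Z %| a)%Z.
    have -> : a = (a + 18%:R * b) - 18%:R * b by ring.
    by rewrite rpredB // dvdz_mull.
  by move: (coprimez_prime cop p_pr pa); rewrite pb.
have ha : ~~ (p%:Z %| a)%Z.
  apply/negP => pa; have : (p%:Z %| 18%:R * b)%Z.
    have -> : 18%:R * b = (a + 18%:R * b) - a by ring.
    by rewrite rpredB.
  by rewrite euclidz // (negPf hb) p5.
have hA : veq A 0 by apply: (veq_int0 Qp p_pr).
have hB : veq B 0 by apply: (veq_int0 Qp p_pr).
have hAB : veq (A * B) 0 by have := veqM Qp hA hB; rewrite addr0.
pose S : K := A + 18%:R * B.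
have eS : (a + 18%:R * b)%:~R = S by rewrite /S rmorphD rmorphM.
have hS1 : vge S 1 by rewrite -eS; apply/(vge_intP Qp p_pr).
(* The constant term is [(-18)^2 + 11 * (-18) - 1 = 125]. Hence [v Q] is 2 when [v S = 1], and
   exactly 3 as soon as [v S >= 2]. *)
have eQ : Q = S ^+ 2 + (- (5%:R ^+ 2 * B * S) + 5%:R ^+ 3 * B ^+ 2).
  by rewrite /Q C5_quad_K -/A -/B /S; ring.
have eAB : A ^+ 2 + B ^+ 2 = - (36%:R * (B * S)) + (S ^+ 2 + 13%:R * 5%:R ^+ 2 * B ^+ 2).
  by rewrite /S; ring.
have h36 : veq (36%:R : K) 0 by apply: (veq_nat0 Qp p_pr); rewrite p5.
have h27 : veq (- 27%:R : K) 0 by apply: (veqN Qp); apply: (veq_nat0 Qp p_pr); rewrite p5.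
have h54 : veq (- 54%:R : K) 0 by apply: (veqN Qp); apply: (veq_nat0 Qp p_pr); rewrite p5.
have n5 := hpi.1; have n1 : (1 : K) != 0 := oner_neq0 _.
set t' := Q + 4%:R * 5%:R ^+ 3 * A * B; set t := Q - 2%:R * 5%:R ^+ 3 * A * B.
have c4E (h : vge Q 2) : veq (- 27%:R * wc4 E / 1 ^+ 4) 1.
  rewrite expr1n divr1 c4_EC5 -/A -/B -/Q.
  have hm : vge (Q - 10%:R * A * B) 0 by vg Qp.
  have hd : veq (5%:R * (A * B) ^+ 2 + Q * (Q - 10%:R * A * B)) 1.
    by apply: (veqD Qp); [have := veqM Qp hpi (veq0X Qp 2 hAB); rewrite addr0 | vg Qp].
  by have := veqM Qp h27 hd; rewrite add0r.
rewrite /c; case: ifPn => h25.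
  have hS2 : vge S 2.
    move: h25 => /dvdzP [k ek]; rewrite -eS ek rmorphM /=.
    have -> : (25%:Z)%:~R = 5%:R ^+ 2 :> K by rewrite -natrX.
    have hk := vge_int Qp k; vg Qp.
  have hQ : veq Q 3.
    rewrite eQ addrC -addrA addrC -addrA; apply: (veqD Qp); last by vg Qp.
    by have := veqM Qp (veqX Qp 3 hpi) (veq0X Qp 2 hB).
  have hs : vge (A ^+ 2 + B ^+ 2) 2 by rewrite eAB; vg Qp.
  have ht : vge t 3 by rewrite /t; vg Qp.
  have ht' : vge t' 3 by rewrite /t'; vg Qp.
  split.
    apply: (additive_III Qp p_pr p5' n1); first by apply: c4E; vg Qp.
    rewrite expr1n divr1 c6_EC5 -/A -/B -/Q.
    have h : vge ((A * B) ^+ 2 - Q * (Q - 4%:R * A * B)) 0.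
      have hm : vge (Q - 4%:R * A * B) 0 by vg Qp.
      by vg Qp.
    by vg Qp.
  (* The second equation is not minimal: [c4] has valuation 5 and [c6] at least 8. Scaling by
     [l = 5] brings these to 1 and at least 2. *)
  apply: (additive_III Qp p_pr p5' n5).
    rewrite c4_EC5t -/A -/B -/Q -/t.
    have h : veq (5%:R ^+ 5 * (A * B) ^+ 2 + Q * t) 5.
      by apply: (veqD Qp); [have := veqM Qp (veqX Qp 5 hpi) (veq0X Qp 2 hAB) | vg Qp].
    by have := veqM Qp (veqM Qp h27 h) (veqV Qp (veqX Qp 4 hpi)).
  rewrite c6_EC5t -/A -/B -/Q -/t'.
  have h : vge (5%:R ^+ 6 * (A * B) ^+ 2 - Q * t') 6 by vg Qp.
  by apply: (vge_divr Qp (veqX Qp 6 hpi) (m := 8)) => //; vg Qp.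
have hSu : veq S 1.
  have [//|hS2] := vge_cases hS1; case/negP: h25.
  case/dvdzP: (hS) => k ek; rewrite ek.
  have -> : 25 = 5%:Z * 5%:Z by [].
  rewrite dvdz_mul2r //.
  have := vge_mulr_cancel Qp hpi (x := k%:~R) (m := 2).
  have -> : k%:~R * 5%:R = S by rewrite -eS ek rmorphM.
  by move/(_ hS2)/(vge_intP Qp p_pr); rewrite p5.
have hQ : veq Q 2.
  by rewrite eQ; apply: (veqD Qp (veqX Qp 2 hSu)); vg Qp.
have hs : veq (A ^+ 2 + B ^+ 2) 1.
  rewrite eAB; apply: (veqD Qp); last by vg Qp.
  by apply: (veqN Qp); have := veqM Qp h36 (veqM Qp hB hSu).
have ht : vge t 2 by rewrite /t; vg Qp.
have ht' : vge (4%:R * 5%:R ^+ 3 * A * B) 3 by vg Qp.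
split.
  apply: (additive_II Qp p_pr p5' n1); first by apply: veq_vge; apply: c4E; vg Qp.
  rewrite expr1n divr1 c6_EC5 -/A -/B -/Q.
  have h : veq ((A * B) ^+ 2 - Q * (Q - 4%:R * A * B)) 0.
    have hm : vge (Q - 4%:R * A * B) 0 by vg Qp.
    by apply: (veqD Qp (veq0X Qp 2 hAB)); vg Qp.
  by have := veqM Qp h54 (veqM Qp hs h).
apply: (additive_IIstar Qp p_pr p5' n1).
  rewrite expr1n divr1 c4_EC5t -/A -/B -/Q -/t.
  have h : vge (5%:R ^+ 5 * (A * B) ^+ 2 + Q * t) 4 by vg Qp.
  by vg Qp.
rewrite expr1n divr1 c6_EC5t -/A -/B -/Q.
have h : veq (5%:R ^+ 6 * (A * B) ^+ 2 - Q * t') 4.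
  have -> : 5%:R ^+ 6 * (A * B) ^+ 2 - Q * t' =
    - (Q ^+ 2) + (5%:R ^+ 6 * (A * B) ^+ 2 - Q * (4%:R * 5%:R ^+ 3 * A * B)) by rewrite /t'; ring.
  by apply: (veqD Qp (veqN Qp (veqX Qp 2 hQ))); vg Qp.
by have := veqM Qp h54 (veqM Qp hs h).
Qed.

End LocalData.

Unset Implicit Arguments.

Theorem theorem3p1 (a b : int) (p : nat) (K : fieldType) (v : K -> int) :
  coprimez a b -> a * b != 0 -> prime p -> is_Qp v p ->
  let E := intK K (EC5 a b) in
  let Et := intK K (EC5t a b) in
  let q := a ^+ 2 + 11%:R * a * b - b ^+ 2 in
  let badcond := [\/ (p%:Z %| a * b)%Z,
                     (7 <= p)%N /\ (p%:Z %| q)%Z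
                   | p = 5%N /\ (5 %| a + 18%:R * b)%Z] in
  [/\ (bad_reduction v E <-> badcond) /\ (bad_reduction v Et <-> badcond),
      (let n := vpz p (a * b) in
       (0 < n)%N -> tamagawa v E (5 * n) /\ tamagawa v Et n),
      (let n := vpz p q in
       (7 <= p)%N -> (0 < n)%N ->
       (legendre (- 5%:R * (a ^+ 2 + b ^+ 2)) p = 1 ->
          tamagawa v E n /\ tamagawa v Et (5 * n)) /\
       (legendre (- 5%:R * (a ^+ 2 + b ^+ 2)) p = -1 ->
          if ~~ odd n then tamagawa v E 2 /\ tamagawa v Et 2
          else tamagawa v E 1 /\ tamagawa v Et 1))
    & (p = 5%N ->
       ((5 %| a + 18%:R * b)%Z /\ ~~ (25 %| a + 18%:R * b)%Z ->
          tamagawa v E 1 /\ tamagawa v Et 1) /\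
       ((25 %| a + 18%:R * b)%Z -> tamagawa v E 2 /\ tamagawa v Et 2))].
Proof.
move=> cop ab0 p_pr Qp E Et q badcond.
have bad : badcond -> bad_reduction v E /\ bad_reduction v Et.
  case=> [h|[p7 h]|[p5 h]].
  - by have [[_ ?] [_ ?]] := split_case Qp p_pr cop ab0 h.
  - by have [? _ _] := node_case Qp p_pr cop p7 h.
  by have [[_ ?] [_ ?]] := five_case Qp p_pr cop p5 h.
have good : badcond \/ ~ bad_reduction v E /\ ~ bad_reduction v Et.
  have [hab|hab] := boolP (p%:Z %| a * b)%Z; first by left; apply: Or31.
  have [hq|hq] := boolP (p%:Z %| C5_quad a b)%Z; last by right; apply: (good_cases Qp p_pr).
  left; have [p7|p7] := leqP 7 p; first by apply: Or32.
  (* A prime below 7 dividing [q] can only be 5, since 2 and 3 are excluded by congruences. *)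
  apply: Or33; case: p p_pr p7 hq {hab Qp bad badcond} => [|[|[|[|[|[|[|p']]]]]]] // _ _ hq.
  - by move: (C5_quad_mod2 cop); rewrite hq.
  - by move: (C5_quad_mod3 cop); rewrite hq.
  by split=> //; apply: (C5_quad_mod5 hq).
split.
- by split; (split; [by case: good => // -[] | by case/bad]).
- move=> n n0; have h : (p%:Z %| a * b)%Z by rewrite (dvdz_logn p_pr ab0).
  by have [[? _] [? _]] := split_case Qp p_pr cop ab0 h.
- move=> n p7 n0; have h : (p%:Z %| q)%Z.
    by rewrite (dvdz_logn p_pr) //; apply: (C5_quad_neq0 cop).
  have [_ h1 h2] := node_case Qp p_pr cop p7 h; split=> // /h2.
  by rewrite -/(vpz p q) -/n; case: odd.
move=> p5; split=> [[h5 h25]|h25].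
  by have := five_case Qp p_pr cop p5 h5; rewrite (negPf h25) => -[[? _] [? _]].
have h5 : (5 %| a + 18%:R * b)%Z by apply: dvdz_trans h25.
by have := five_case Qp p_pr cop p5 h5; rewrite h25 => -[[? _] [? _]].
Qed.
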